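(* Let $\alpha \in (0,1)$. The set of functions $f \in C^{\alpha}[0,1]$ whose graph satisfies $$\dim_{\mathcal{H}}(f) = \dim_{B}(f) = 2-\alpha$$ is strongly $\mathfrak{c}$-algebrable.
   Context: A function is identified with its graph: for $f:[0,1]\to\mathbb{R}$, $\dim_{\mathcal H}(f)$ and $\dim_B(f)$ denote the Hausdorff dimension and the box dimension of $\{(x,f(x)) : x\in[0,1]\}\subseteq\mathbb{R}^2$. For a bounded set $E\subseteq\mathbb{R}^d$, $N_\delta(E)$ is the minimal number of cubes of size $\delta$ needed to cover $E$, and $\dim_B(E)=\lim_{\delta\to0^+}\frac{\log N_\delta(E)}{-\log\delta}$ when this limit exists (so $\dim_B(f)=2-\alpha$ includes the existence of the limit). $C^{\alpha}[0,1]$ is the set of functions $f:[0,1]\to\mathbb{R}$ for which there is $C>0$ with $|f(x)-f(y)|\le C|x-y|^{\alpha}$ for all $x,y\in[0,1]$; it is an algebra under pointwise operations. $\mathfrak{c}$ is the cardinality of $\mathbb{R}$. Strong algebrability: for a commutative algebra $\mathcal{A}$ (here real functions with pointwise operations) and a cardinal $\kappa$, a subset $\mathcal{B}\subseteq\mathcal{A}$ is strongly $\kappa$-algebrable if there is a $\kappa$-generated free algebra contained in $\mathcal{B}\cup\{0\}$, i.e. there is a set $X\subseteq\mathcal{A}$ of cardinality $\kappa$ such that (1) the subalgebra generated by $X$ (all $P(x_1,\dots,x_n)$ with $x_1,\dots,x_n\in X$ and $P$ a real polynomial without constant term) is contained in $\mathcal{B}\cup\{0\}$, and (2) $X$ is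 free: for every polynomial $P$ without constant term and any distinct $x_1,\dots,x_n\in X$, $P(x_1,\dots,x_n)=0$ if and only if $P=0$. *)

(* Defs.v *)
From HB Require Import structures.
From mathcomp Require Import all_boot all_order all_algebra.
From mathcomp Require Import all_classical all_reals all_analysis.
(* The notations of mpoly clash with those of analysis. *)
From mathcomp Require Import -(notations) mpoly.

Set Implicit Arguments.
Unset Strict Implicit.
Unset Printing Implicit Defensive.

Import Order.TTheory GRing.Theory Num.Theory.
Import numFieldNormedType.Exports.

Local Open Scope classical_set_scope.
Local Open Scope ring_scope.

Section FunctionAlgebra.
Variables (T : pointedType) (R : comNzRingType).

Lemma fct_scalerAl (a : R) (u v : T -> R^o) : a *: (u * v) = (a *: u) * v.
Proof. by apply/funext => t; exact: mulrA. Qed.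

HB.instance Definition _ :=
  GRing.Lmodule_isLalgebra.Build R (T -> R^o) fct_scalerAl.
HB.instance Definition _ := GRing.Lalgebra_isComAlgebra.Build R (T -> R^o).

End FunctionAlgebra.

Section StrongAlgebrability.
Variables (R : comNzRingType) (A : comAlgType R).

Definition no_constant_term n (P : mpoly n R) : Prop := mcoeff mnm0 P = 0.

Definition alg_eval n (x : 'I_n -> A) (P : mpoly n R) : A :=
  mmap (in_alg A) x P.

Definition generated_subalgebra (X : set A) : set A :=
  [set a | exists n (x : 'I_n -> A) (P : mpoly n R),
    [/\ forall i, X (x i), no_constant_term P & a = alg_eval x P]].

Definition free_generators (X : set A) : Prop :=
  forall n (x : 'I_n -> A) (P : mpoly n R),
    injective x -> (forall i, X (x i)) -> no_constant_term P ->
    (alg_eval x P = 0 <-> P = 0).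

(* The cardinal kappa is given as the cardinality of a set K. *)
Definition strongly_algebrable (U : Type) (K : set U) (B : set A) : Prop :=
  exists X : set A, [/\ (X #= K)%card,
    generated_subalgebra X `<=` B `|` [set 0] & free_generators X].

End StrongAlgebrability.

Section Dimensions.
Variables (R : realType) (d : nat).
Implicit Types (E : set 'rV[R]_d) (s delta : R).

(* The library norm on 'rV[R]_d is the sup norm. *)
Definition eucl_dist (x y : 'rV[R]_d) : R :=
  Num.sqrt (\sum_(i < d) (x 0 i - y 0 i) ^+ 2).

(* -oo on the empty set, hence the case distinction in diam_pow. *)
Definition diameter E : \bar R :=
  ereal_sup [set (eucl_dist x y)%:E | x in E & y in E].

(* Also for s = 0: the empty set counts 0 and a singleton counts 1. *)
Definition diam_pow s E : \bar R :=
  if E == set0 then 0%E else poweR (diameter E) s.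

Definition hausdorff_content s delta E : \bar R :=
  ereal_inf [set (\sum_(0 <= k <oo) diam_pow s (U k))%E |
    U in [set U : nat -> set 'rV[R]_d |
      E `<=` \bigcup_k U k /\ forall k, (diameter (U k) <= delta%:E)%E]].

Definition hausdorff_measure s E : \bar R :=
  ereal_sup [set hausdorff_content s delta E | delta in [set t : R | 0 < t]].

Definition hausdorff_dim E : \bar R :=
  ereal_inf [set s%:E |
    s in [set s : R | 0 <= s /\ hausdorff_measure s E = 0%E]].

Definition cube delta (a : 'rV[R]_d) : set 'rV[R]_d :=
  [set x | forall i, a 0 i <= x 0 i <= a 0 i + delta].

(* +oo when there is no finite cover, i.e. when E is unbounded. *)
Definition covering_number delta E : \bar R :=
  ereal_inf [set (n%:R)%:E | n in [set n : nat |
    exists a : 'I_n -> 'rV[R]_d, E `<=` \bigcup_i cube delta (a i)]].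

(* The limit defining the box dimension exists and equals D. *)
Definition has_box_dim E (D : \bar R) : Prop :=
  (lne (covering_number delta E) / (- ln delta)%:E)%E
    @[delta --> (0 : R)^'+] --> D.

End Dimensions.

Section RealFunctions.
Variable R : realType.

Definition unit_interval : Type := set_type (`[0, 1]%classic : set R).

HB.instance Definition _ := Choice.copy unit_interval
  (set_type (`[0, 1]%classic : set R)).

Lemma unit_interval0 : (0 : R) \in (`[0, 1]%classic : set R).
Proof. by rewrite inE /= in_itv /= lexx ler01. Qed.

HB.instance Definition _ :=
  isPointed.Build unit_interval (exist _ 0 unit_interval0).

Definition ui_val (x : unit_interval) : R := val x.

Definition holder (alpha : R) : set (unit_interval -> R) :=
  [set f | exists C : R, 0 < C /\
    forall x y, `|f x - f y| <= C * `|ui_val x - ui_val y| `^ alpha].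

Definition graph (f : unit_interval -> R) : set 'rV[R]_2 :=
  [set \row_(j < 2) (if j == 0 then ui_val x else f x) | x in setT].

End RealFunctions.

(* Main.v *)
(** There is one function [F] from which all generators are made.  It is the
self-affine function driven by the ternary digits of [x]: at a "linear" level
the three thirds of a cell are mapped onto the three thirds of its image, at a
"zigzag" level each third is mapped onto the whole image, the middle one
reversed.  If the number of linear levels among the first [n] is
[floor (alpha * n)], a cell of length [3^-n] is mapped onto an interval of length
about [3^(-alpha n)], so [F] is alpha-Hoelder; moreover the cells of a finer level
are equidistributed over the image, so the points of a set of diameter [d] whose
[F]-values differ by at most [d] fit into boxes of total length [O(d^(2 - alpha))].
By the mass distribution principle this forces the dimension [2 - alpha], even
for the restriction of [h o F] to a cell on whose image [h] is bi-Lipschitz.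

The generators are [exp (beta_t * F)] with [t] real and the [beta_t] positive and
linearly independent over the integers.  A polynomial in them without constant
term is [h o F] with [h] an exponential sum without constant term, and a nonzero
such [h] is bi-Lipschitz on some interval inside [0, 1]. *)
Require Import Defs.
From mathcomp Require Import all_boot all_order all_algebra.
From mathcomp Require Import all_classical all_reals all_analysis.
From mathcomp Require Import -(notations) mpoly.
From mathcomp Require Import zify ring lra.

Set Implicit Arguments.
Unset Strict Implicit.
Unset Printing Implicit Defensive.

Import Order.TTheory GRing.Theory Num.Theory.
Import numFieldNormedType.Exports.

Local Open Scope classical_set_scope.
Local Open Scope ring_scope.

(** * Cells of the self-affine function *)

Section Cells.
Variable k : nat -> nat.
Local Open Scope nat_scope.

(* The image index and the orientation ([true] for increasing) of the [a]-th cell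
   of level [n]; [k n] counts the linear levels below [n], and the branches of the
   inner [if] are a zigzag level and a linear one. *)
Fixpoint cell n a : nat * bool :=
  if n is n'.+1 then
    let: (b, s) := cell n' (a %/ 3) in
    let d := a %% 3 in
    if k n == k n' then (b, s (+) (d == 1)) else (3 * b + (if s then d else 2 - d), s)
  else (a, true).

(* The image of the right end of a cell is that of the left end of the next. *)
Lemma cell_adj n a :
  (cell n a.+1).1 + ~~ (cell n a.+1).2 = (cell n a).1 + (cell n a).2.
Proof.
elim: n a => [|n IH] a /=; first by lia.
have {}IH := IH (a %/ 3).
have [d2|d2] : a %% 3 = 2 \/ a %% 3 < 2 by lia.
  have -> : a.+1 %/ 3 = (a %/ 3).+1 by lia.
  have -> : a.+1 %% 3 = 0 by lia.
  rewrite d2; move: IH.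
  case: (cell n (a %/ 3)) => b s; case: (cell n (a %/ 3).+1) => b' s'.
  by case: ifP => _ /=; case: s => /=; case: s' => /=; lia.
have -> : a.+1 %/ 3 = a %/ 3 by lia.
case: (cell n (a %/ 3)) => b s.
have [d1|d1] : a %% 3 = 0 \/ a %% 3 = 1 by lia.
  have -> : a.+1 %% 3 = 1 by lia.
  by rewrite d1; case: ifP => _ /=; case: s => /=; lia.
have -> : a.+1 %% 3 = 2 by lia.
by rewrite d1; case: ifP => _ /=; case: s => /=; lia.
Qed.

Hypothesis kS : forall n, (k n.+1 == k n) || (k n.+1 == (k n).+1).

(** A zigzag level keeps the image interval of the parent and a linear one selects a third of it;
    denominators are cleared to stay in [nat]. *)
Lemma cell_nested n a :
  (cell n (a %/ 3)).1 * 3 ^ k n.+1 <= (cell n.+1 a).1 * 3 ^ k n /\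
  (cell n.+1 a).1.+1 * 3 ^ k n <= (cell n (a %/ 3)).1.+1 * 3 ^ k n.+1.
Proof.
rewrite /=; case: (cell n (a %/ 3)) => b s.
case: ifP => [/eqP -> //|kn] /=.
have := kS n; rewrite kn /= => /eqP ->; rewrite expnS.
have : (if s then a %% 3 else 2 - a %% 3) <= 2 by case: s; lia.
by move: (if s then _ else _) (3 ^ k n) => d q; nia.
Qed.

(** Equidistribution: with the image index prescribed, a zigzag level keeps all three children of a
    cell and a linear level keeps one, so each linear level between [n] and [n + j] divides the
    count by 3. *)
Lemma cell_count n j a0 b : exists2 s : seq nat,
  size s * 3 ^ k (n + j) <= 3 ^ (j + k n) &
  forall a, a %/ 3 ^ j = a0 -> (cell (n + j) a).1 = b -> a \in s.
Proof.
elim: j b => [|j IH] b.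
  exists [:: a0]; first by rewrite addn0 add0n mul1n.
  by move=> a; rewrite divn1 => -> _; rewrite inE.
rewrite addnS; have [kn|kn] := eqVneq (k (n + j).+1) (k (n + j)).
  have [s ss sP] := IH b.
  exists ([seq 3 * x | x <- s] ++ [seq (3 * x).+1 | x <- s]
            ++ [seq (3 * x).+2 | x <- s]).
    by rewrite !size_cat !size_map kn addSn expnS; lia.
  move=> a; rewrite expnS divnMA => /sP {}sP /=.
  rewrite kn eqxx; case: (cell (n + j) (a %/ 3)) sP => b' s' /= sP /sP sa.
  rewrite !mem_cat.
  have [d|[d|d]] : a = 3 * (a %/ 3) \/ a = (3 * (a %/ 3)).+1
      \/ a = (3 * (a %/ 3)).+2 by lia.
  - by rewrite d map_f.
  - by rewrite [in X in _ || (X || _)]d map_f // orbT.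
  - by rewrite [in X in _ || (_ || X)]d map_f // !orbT.
(* At a linear level [b %/ 3] is the image index of the parent; [b %% 3] and the orientation of the
   parent determine the child. *)
have [s ss sP] := IH (b %/ 3).
exists [seq 3 * x + (if (cell (n + j) x).2 then b %% 3 else 2 - b %% 3) | x <- s].
  have := kS (n + j); rewrite (negPf kn) /= => /eqP ->.
  by rewrite size_map addSn !expnS; lia.
move=> a; rewrite expnS divnMA => /sP {}sP /=.
rewrite (negPf kn).
case E : (cell (n + j) (a %/ 3)) sP => [b' s'] /= sP E'.
have -> : a = 3 * (a %/ 3) + (if (cell (n + j) (a %/ 3)).2 then b %% 3 else 2 - b %% 3).
  by rewrite E /=; case: s' E' {E}; lia.
by apply: (map_f (fun x => 3 * x + (if (cell (n + j) x).2 then b %% 3 else 2 - b %% 3)));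
  apply: sP; case: s' E' {E}; lia.
Qed.

Hypothesis k0 : k 0 = 0.

(** A preimage is built level by level: the first child at a zigzag level, the child prescribed by
    the last ternary digit of [b] at a linear one. *)
Lemma cell_onto n b : b < 3 ^ k n -> exists2 a, a < 3 ^ n & (cell n a).1 = b.
Proof.
elim: n b => [|n IH] b; first by rewrite k0 => bn; exists b.
have [kn|kn] := eqVneq (k n.+1) (k n).
  rewrite kn => /IH[a an ab]; exists (3 * a); first by rewrite expnS; lia.
  have aE : (3 * a) %/ 3 = a by lia.
  by rewrite /= kn eqxx aE; case: (cell n a) ab.
have := kS n; rewrite (negPf kn) /= => /eqP kn1 bn.
have /IH[a an ab] : b %/ 3 < 3 ^ k n by move: bn; rewrite kn1 expnS; lia.
exists (3 * a + (if (cell n a).2 then b %% 3 else 2 - b %% 3)).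
  by rewrite expnS; case: (cell n a).2; lia.
rewrite /=.
have -> : (3 * a + (if (cell n a).2 then b %% 3 else 2 - b %% 3)) %/ 3 = a.
  by case: (cell n a).2; lia.
by rewrite (negPf kn); case: (cell n a) ab => b' [] /=; lia.
Qed.

End Cells.

Lemma pow3_gt0 (R : realType) n : 0 < (3 : R) ^+ n.
Proof. by rewrite exprn_gt0. Qed.
#[local] Hint Resolve pow3_gt0 : core.

Lemma pow3_scale (R : realType) (d : R) : 0 < d <= 1 ->
  exists n, 3 ^- n.+1 < d <= 3 ^- n.
Proof.
move=> /andP[d0 d1].
have ex : exists n, 3 ^- n < d.
  have /cvgrPdist_lt /(_ _ d0) [N _ /(_ N (leqnn _))] :=
    @cvg_expr R 3^-1 ltac:(by rewrite ger0_norm; lra).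
  by rewrite sub0r normrN exprVn ger0_norm ?invr_ge0 ?ltW//; exists N.
case: (ex_minnP ex) => -[|n]; first by rewrite expr0 invr1 ltNge d1.
move=> nd nmin; exists n; rewrite nd leNgt; apply/negP => /nmin.
by rewrite ltnn.
Qed.

(** * The self-affine function and its modulus of continuity *)

Section SelfAffine.
Variables (R : realType) (k : nat -> nat).
Hypothesis kS : forall n, (k n.+1 == k n) || (k n.+1 == (k n).+1).
Implicit Types x y : R.

Definition cell_index n x : nat := Num.truncn (3 ^+ n * x).

Lemma cell_index_itv n x : 0 <= x ->
  (cell_index n x)%:R <= 3 ^+ n * x < (cell_index n x).+1%:R.
Proof. by move=> x0; rewrite truncn_itv// mulr_ge0// ltW. Qed.

Lemma cell_index_div n m x : 0 <= x ->
  cell_index n x = (cell_index (n + m) x %/ 3 ^ m)%N.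
Proof.
move=> x0; apply: truncn_def.
have /andP[] := cell_index_itv (n + m) x0.
set a := cell_index (n + m) x; rewrite exprD => h1 h2.
have q0 : 0 < (3 : R) ^+ m by [].
rewrite -(ler_pM2r q0) -(ltr_pM2r q0) [3 ^+ n * x * _]mulrAC.
have -> : (3 : R) ^+ m = (3 ^ m)%:R by rewrite natrX.
rewrite -!natrM natrX.
apply/andP; split.
- by apply: le_trans h1; rewrite ler_nat; exact: leq_trunc_div.
- apply: lt_le_trans h2 _; rewrite ler_nat.
  by rewrite ltn_ceil // expn_gt0.
Qed.

(** The image interval of the cell of [x] at level [n] starts here and has length [3 ^- k n]. *)
Definition cell_low n x : R := (cell k n (cell_index n x)).1%:R / 3 ^+ k n.

Lemma cell_low_nested n m x : 0 <= x -> (n <= m)%N ->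
  cell_low n x <= cell_low m x /\
  cell_low m x + 3 ^- k m <= cell_low n x + 3 ^- k n.
Proof.
move=> x0 /subnK <-; elim: (m - n)%N => [|j [IH1 IH2]]; first by split.
rewrite addSn; set l := (j + n)%N in IH1 IH2 *.
have [] := cell_nested kS l (cell_index l.+1 x).
rewrite -[X in (_ %/ X)%N](expn1 3) -{-4}[l.+1]addn1 -cell_index_div// addn1.
rewrite -!(ler_nat R) !natrM !natrX => h1 h2.
have k1 : 0 < (3 : R) ^+ k l by [].
have k2 : 0 < (3 : R) ^+ k l.+1 by [].
split.
- apply: le_trans IH1 _; rewrite /cell_low ler_pdivrMr// mulrAC ler_pdivlMr//.
- apply: le_trans IH2; rewrite /cell_low.
  have sE a i : a%:R / 3 ^+ i + 3 ^- i = a.+1%:R / 3 ^+ i :> R.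
    by rewrite -[a.+1%:R]natr1 mulrDl mul1r.
  rewrite !sE.
  by rewrite ler_pdivrMr// mulrAC ler_pdivlMr// mulrC.
Qed.

(** For [0 <= x] the lower ends increase with the level, so the supremum is their limit and lies in
    every image interval. *)
Definition self_affine x : R := sup (range (cell_low ^~ x)).

Lemma self_affine_itv n x : 0 <= x ->
  cell_low n x <= self_affine x <= cell_low n x + 3 ^- k n.
Proof.
move=> x0.
have ub : ubound (range (cell_low ^~ x)) (cell_low n x + 3 ^- k n).
  move=> _ [m _ <-]; have [nm|/ltnW mn] := leqP n m.
    have [_] := cell_low_nested x0 nm; apply: le_trans.
    by rewrite lerDl invr_ge0 ltW.
  by have [le _] := cell_low_nested x0 mn; rewrite (le_trans le)// lerDl invr_ge0 ltW.
apply/andP; split; last by apply: ge_sup => //; exists (cell_low n x), n.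
by apply: sup_upper_bound; [split; [exists (cell_low n x), n | eexists; exact: ub] | exists n].
Qed.

(** The two points lie in the same or in adjacent cells. By [cell_adj] the image intervals of
    adjacent cells share an end or coincide, so their lower ends differ by at most one length. *)
Lemma self_affine_near n x y : 0 <= x -> 0 <= y -> `|x - y| <= 3 ^- n ->
  `|self_affine x - self_affine y| <= 2 / 3 ^+ k n.
Proof.
wlog xy : x y / x <= y => [H x0 y0 d|x0 y0 d].
  by have /orP[xy|xy] := le_total x y; [|rewrite distrC; rewrite distrC in d]; exact: H.
have /andP[x1 x2] := cell_index_itv n x0.
have /andP[y1 y2] := cell_index_itv n y0.
have q0 : 0 < (3 : R) ^+ n by [].
have dq : 3 ^+ n * y <= 3 ^+ n * x + 1.
  move: d; rewrite distrC ger0_norm ?subr_ge0// -[_^-1]mul1r ler_pdivlMr//; lra.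
have ab1 : (cell_index n x <= cell_index n y)%N by rewrite le_truncn// ler_pM2l.
have ab2 : (cell_index n y <= (cell_index n x).+1)%N.
  rewrite -ltnS -(ltr_nat R) (le_lt_trans y1)// (le_lt_trans dq)//.
  by rewrite -[in X in _ < X]natr1 ltrD2r.
have /andP[fx1 fx2] := self_affine_itv n x0.
have /andP[fy1 fy2] := self_affine_itv n y0.
have : `|cell_low n x - cell_low n y| <= 3 ^- k n.
  have [ab|ab] : cell_index n y = cell_index n x
      \/ cell_index n y = (cell_index n x).+1.
    by move: ab1 ab2; move: (cell_index n x) (cell_index n y) => a b; clear; lia.
    by rewrite /cell_low ab subrr normr0 invr_ge0 ltW.
  have adj := cell_adj k n (cell_index n x).
  have q1 : 0 <= (3 : R) ^- k n by rewrite invr_ge0 ltW.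
  rewrite /cell_low ab -mulrBl normrM (ger0_norm q1).
  rewrite -[X in _ <= X]mul1r ler_wpM2r//.
  have le1 : (forall a b : nat, (a <= b.+1)%N -> (b <= a.+1)%N -> `|a%:R - b%:R : R| <= 1).
    move=> a b; rewrite -!(ler_nat R) -!natr1 => h1 h2.
    by rewrite ler_norml; lra.
  apply: le1; move: adj; move: (cell_index n x).+1 (cell_index n x) => a b; clear;
    case: (cell k n _) => [? []]; case: (cell k n _) => [? []] /=; lia.
rewrite !ler_norml => /andP[].
by move: (3 ^- k n) fx1 fx2 fy1 fy2 => q; lra.
Qed.

Hypothesis k0 : k 0%N = 0%N.

Lemma self_affine_onto n b : (b < 3 ^ k n)%N ->
  exists x, [/\ 0 <= x, x < 1 & cell_low n x = b%:R / 3 ^+ k n].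
Proof.
move=> /(cell_onto kS k0)[a an ab]; exists (a%:R / 3 ^+ n); split.
- by rewrite divr_ge0// ltW.
- by rewrite ltr_pdivrMr// mul1r -natrX ltr_nat.
- by rewrite /cell_low /cell_index [3 ^+ n * _]mulrC divfK ?gt_eqF// natrK ab.
Qed.

End SelfAffine.

(** * Linear levels of density [alpha] *)

Section Rate.
Variables (R : realType) (alpha : R).
Hypothesis halpha : 0 < alpha < 1.

Definition rate n : nat := Num.truncn (alpha * n%:R).

Lemma rate_itv n : (rate n)%:R <= alpha * n%:R < (rate n).+1%:R.
Proof. by have /andP[a0 _] := halpha; rewrite truncn_itv// mulr_ge0// ltW. Qed.

Lemma rate0 : rate 0 = 0%N.
Proof. by rewrite /rate mulr0 truncn0. Qed.

Lemma rateS n : (rate n.+1 == rate n) || (rate n.+1 == (rate n).+1).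
Proof.
have /andP[a0 a1] := halpha.
have /andP[h1 h2] := rate_itv n; have /andP[h3 h4] := rate_itv n.+1.
have le1 : (rate n < (rate n.+1).+1)%N.
  by rewrite -(ltr_nat R) (le_lt_trans h1)// (le_lt_trans _ h4)// ler_pM2l// ler_nat.
have le2 : (rate n.+1 < (rate n).+2)%N.
  rewrite -(ltr_nat R) (le_lt_trans h3)//.
  by move: h2; rewrite -[n.+1%:R]natr1 -[_.+2%:R]natr1 mulrDr; lra.
by move: le1 le2; move: (rate n) (rate n.+1) => a b; clear; lia.
Qed.

(** [rate] grows by steps of at most one, so the least [n] with [m <= rate n] gives equality;
    [alpha < 1] gives [m <= n]. *)
Lemma rate_onto m : exists2 n, (m <= n)%N & rate n = m.
Proof.
have /andP[a0 a1] := halpha.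
have ex : exists n, (m <= rate n)%N.
  exists (Num.truncn (m%:R / alpha)).+1.
  rewrite truncn_ge_nat ?mulr_ge0 ?(ltW a0)// mulrC -ler_pdivrMr//.
  by rewrite ltW// truncnS_gt.
case: (ex_minnP ex) => n mn nmin; exists n; last first.
  case: n mn nmin => [|n] mn nmin; first by move: mn; rewrite rate0 leqn0 => /eqP.
  have /negP : ~ (m <= rate n)%N by move=> /nmin; rewrite ltnn.
  by case/orP: (rateS n) mn => /eqP ->; move: (rate n) => r; clear; lia.
rewrite (leq_trans mn)// -(ler_nat R).
have /andP[h _] := rate_itv n; rewrite (le_trans h)//.
by rewrite -[X in _ <= X]mul1r ler_wpM2r// ltW.
Qed.

Lemma pow3_rate_le n : 3 ^+ rate n <= (3 ^+ n) `^ alpha.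
Proof.
have /andP[h _] := rate_itv n.
rewrite -!powR_mulrn// -powRrM [n%:R * _]mulrC ler_powR//.
by rewrite ler1n.
Qed.

(** Rounding [alpha * n] down loses less than one unit of exponent, hence at most a factor 3. *)
Lemma pow3_rate_ge n : (3 ^+ n) `^ alpha <= 3 * 3 ^+ rate n.
Proof.
have /andP[_ h] := rate_itv n.
rewrite -exprS -!powR_mulrn// -powRrM [n%:R * _]mulrC ler_powR//.
  by rewrite ler1n.
exact: ltW.
Qed.
End Rate.

(** * Measure of parameter sets on which both coordinates vary little *)

Lemma seq_itv_cover (R : realType) n (s : seq nat) : exists W : set R,
  [/\ measurable W, (lebesgue_measure W <= ((size s)%:R / 3 ^+ n)%:E)%E &
   forall x : R, 0 <= x -> cell_index n x \in s -> W x].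
Proof.
elim: s => [|a s [W [mW lW sW]]].
  by exists set0; split => //; rewrite measure0 mul0r.
exists (`[a%:R / 3 ^+ n, a.+1%:R / 3 ^+ n] `|` W); split.
- exact: measurableU.
- apply: (le_trans (measureU2 _ _ _)) => //=.
  rewrite [X in (_ <= X)%E](_ : _ = (1 / 3 ^+ n)%:E + ((size s)%:R / 3 ^+ n)%:E)%E.
    apply: leeD => //; rewrite lebesgue_measure_itv /= lte_fin.
    case: ifP => _; last by rewrite lee_fin divr_ge0// ltW.
    by rewrite -EFinB lee_fin -mulrBl -natr1 addrAC subrr add0r.
  by rewrite -EFinD -mulrDl -[(size s).+1%:R]natr1 addrC.
- move=> x x0; rewrite inE => /orP[/eqP ax|]; last by right; exact: sW.
  left; rewrite /= in_itv /=.
  have /andP[h1 h2] := cell_index_itv n x0.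
  by rewrite ler_pdivrMr// ler_pdivlMr// mulrC -ax h1 ltW.
Qed.

Lemma size_flatten_le (T : Type) (ss : seq (seq T)) (q M : nat) :
  all (fun s => size s * q <= M)%N ss -> (size (flatten ss) * q <= size ss * M)%N.
Proof.
elim: ss => //= s ss IH /andP[h /IH {}IH].
by rewrite size_cat mulnDl mulSn leq_add.
Qed.

Lemma powRVl (R : realType) (x r : R) : 0 <= x -> x^-1 `^ r = (x `^ r)^-1.
Proof. by move=> x0; rewrite -powR_inv1// -powRrM mulN1r powRN. Qed.

(** The upper bounds are not strict because a value of the function can be the right end of its
    image interval; hence the slack 2 rather than 1. *)
Lemma natr_close (R : realType) (a b : nat) (u v : R) : a%:R <= u <= a.+1%:R ->
  b%:R <= v <= b.+1%:R -> `|u - v| <= 1 -> (a <= b + 2)%N && (b <= a + 2)%N.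
Proof.
rewrite ler_norml -![_.+1%:R]natr1 => /andP[a1 a2] /andP[b1 b2] /andP[c1 c2].
by rewrite -!(ler_nat R) !natrD; apply/andP; split; lra.
Qed.

(* At the level [n] with [d] about [3^-n] the set meets boundedly many cells; subdivide
   them down to the level [N] where the images too have length [3^-n], and keep
   the subcells whose image is near the values taken on the set. *)
Lemma level_set_small (R : realType) (alpha : R) (E : set R) (d : R) :
  0 < alpha < 1 -> 0 < d <= 1 -> (forall x, E x -> 0 <= x) ->
  (forall x y, E x -> E y -> `|x - y| <= d /\
     `|self_affine (rate alpha) x - self_affine (rate alpha) y| <= d) ->
  exists W, [/\ measurable W, E `<=` W &
    (lebesgue_measure W <= (225 * d `^ (2 - alpha))%:E)%E].
Proof.
set F : R -> R := self_affine (rate alpha).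
move=> halpha hd E0 Ed; have /andP[a0 a1] := halpha.
have [->|/set0P[x0 Ex0]] := eqVneq E set0.
  by exists set0; split => //; rewrite measure0 lee_fin mulr_ge0// powR_ge0.
have [n /andP[nd dn]] := pow3_scale hd.
have [N nN kN] := rate_onto halpha n.
pose value (x : R) := (cell (rate alpha) N (cell_index N x)).1.
pose a0' := cell_index n x0; pose b0 := value x0.
have cc a b := cid2 (cell_count (rateS halpha) n (N - n) a b).
pose S a b : seq nat := sval (cc a b).
have SP a b x : 0 <= x -> cell_index n x = a -> value x = b -> cell_index N x \in S a b.
  move=> x_ge0 xa xb; rewrite /S; case: (cc a b) => s _ /= /(_ (cell_index N x)).
  rewrite subnKC// => h.
  by apply: h => //; rewrite -xa (cell_index_div n (N - n) x_ge0) subnKC.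
have Ss a b : (size (S a b) * 3 ^ n <= 3 ^ (N - n + rate alpha n))%N.
  by rewrite /S; case: (cc a b) => s /=; rewrite subnKC// kN.
(* By [natr_close] both indices are within 2 of those of [x0], which leaves 5 times 5 pairs.
   Truncated subtraction only repeats the index 0. *)
pose s := flatten [seq S (a0' + i - 2)%N (b0 + j - 2)%N | i <- iota 0 5, j <- iota 0 5].
have [W [mW lW sW]] := seq_itv_cover R N s.
have q0 : 0 < (3 : R) ^+ n by [].
exists W; split => //.
  move=> x Ex; apply: sW (E0 _ Ex) _.
  have [dx dF] := Ed _ _ Ex Ex0.
  have scale u v : `|u - v| <= d -> `|3 ^+ n * u - 3 ^+ n * v| <= 1.
    rewrite -mulrBr normrM (gtr0_norm q0) => h.
    by rewrite mulrC -ler_pdivlMr// mul1r (le_trans h).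
  have /andP[x1 x2] := cell_index_itv n (E0 _ Ex).
  have /andP[x3 x4] := cell_index_itv n (E0 _ Ex0).
  have /natr_close : (cell_index n x)%:R <= 3 ^+ n * x <= (cell_index n x).+1%:R.
    by rewrite x1 ltW.
  move=> /(_ a0' (3 ^+ n * x0)); rewrite x3 (ltW x4) => /(_ isT (scale _ _ dx)) ca.
  have valP y : E y -> (value y)%:R <= 3 ^+ n * F y <= (value y).+1%:R.
    move=> Ey; have := self_affine_itv (rateS halpha) N (E0 _ Ey).
    rewrite /cell_low kN -/(value y) => /andP[h1 h2].
    move: h1 h2; rewrite -[X in _ + X]mul1r -mulrDl natr1 ler_pdivrMr// ler_pdivlMr//.
    by rewrite mulrC => -> ->.
  have cb := natr_close (valP _ Ex) (valP _ Ex0) (scale _ _ dF).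
  apply/flattenP; exists (S (cell_index n x) (value x)); last by exact: SP (E0 _ Ex) _ _.
  apply/allpairsP; exists (cell_index n x + 2 - a0', value x + 2 - b0)%N.
  move: ca cb; rewrite -/b0; move: (cell_index n x) (value x) => a b.
  clearbody a0' b0 S; clear => /andP[ca1 ca2] /andP[cb1 cb2].
  by split; rewrite ?mem_iota /=; [lia|lia|congr S; lia].
apply: (le_trans lW); rewrite lee_fin.
have sz : (size s * 3 ^ n <= 25 * 3 ^ (N - n + rate alpha n))%N.
  apply: leq_trans (size_flatten_le _) _; last by rewrite size_allpairs !size_iota.
  by apply/allP => t /allpairsP[[i j] [_ _ ->]]; exact: Ss.
have q1 : 0 <= (3 : R) ^+ n by exact: ltW.
have c0 : 0 < (3 : R) ^+ N by [].
have d3p : 0 < 3 * d by case/andP: hd => d0 _; rewrite mulr_gt0.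
have d3 : 3 ^- n <= 3 * d.
  by move: nd; rewrite exprS invfM => /ltW; rewrite ler_pdivrMl.
(* There are at most 25 times [3 ^ (N - n + rate alpha n - n)] cells, each of length [3 ^- N], so
   [N] cancels. *)
have step : (size s)%:R / 3 ^+ N <= 25 * (3 ^- n) `^ (2 - alpha).
  rewrite ler_pdivrMr// -(ler_pM2r q0).
  move: sz; rewrite -(ler_nat R) !natrM !natrX => /le_trans; apply.
  rewrite -!mulrA ler_pM2l// exprD powRVl//.
  rewrite powRB; last by apply/implyP => _; rewrite gt_eqF.
  rewrite powR_mulrn// invf_div.
  have -> : (3 : R) ^+ N = 3 ^+ (N - n) * 3 ^+ n by rewrite -exprD subnK.
  rewrite (_ : _ * (3 ^+ (N - n) * 3 ^+ n * 3 ^+ n) = 3 ^+ (N - n) * (3 ^+ n) `^ alpha).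
    by rewrite ler_pM2l// pow3_rate_le.
  by field; rewrite gt_eqF.
apply: le_trans step _.
have le2 : 0 <= 2 - alpha by move: a1; clear; lra.
(* The factor 9 bounds the power [2 - alpha] of the 3 lost in replacing [3 ^- n] by [3 * d]. *)
have -> : 225 = 25 * 3 ^+ 2 :> R by rewrite expr2; clear; lra.
rewrite -mulrA ler_pM2l//.
apply: (@le_trans _ _ ((3 * d) `^ (2 - alpha))).
  by rewrite ge0_ler_powR// nnegrE ?invr_ge0 ltW.
have d0 : 0 <= d by case/andP: hd => /ltW.
rewrite powRM//.
rewrite ler_wpM2r ?powR_ge0// -powR_mulrn// ler_powR//.
- by clear; lra.
- by move: a0; clear; lra.
Qed.


(** Extends the bound to every [d]: for [d = 0] the set has at most one point, and for [d > 1] the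
    unit interval is small enough. *)
Lemma level_set (R : realType) (alpha : R) (E : set R) (d : R) :
  0 < alpha < 1 -> 0 <= d -> (forall x, E x -> 0 <= x <= 1) ->
  (forall x y, E x -> E y -> `|x - y| <= d /\
     `|self_affine (rate alpha) x - self_affine (rate alpha) y| <= d) ->
  exists W, [/\ measurable W, E `<=` W &
    (lebesgue_measure W <= (225 * d `^ (2 - alpha))%:E)%E].
Proof.
move=> halpha; have /andP[a0 a1] := halpha.
rewrite le_eqVlt => /orP[/eqP <-|d0] E0 Ed.
  have [->|/set0P[x0 Ex0]] := eqVneq E set0.
    by exists set0; split => //; rewrite measure0 lee_fin mulr_ge0// powR_ge0.
  exists [set x0]; split => //.
    move=> x Ex; have [] := Ed _ _ Ex Ex0.
    by rewrite normr_le0 subr_eq0 => /eqP.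
  by rewrite lebesgue_measure_set1 lee_fin mulr_ge0// powR_ge0.
have [d1|d1] := leP d 1.
  by apply: level_set_small => //; [rewrite d0|move=> x /E0 /andP[]].
exists (`[0, 1]%classic : set R); split => //.
rewrite lebesgue_measure_itv /= lte_fin ltr01 -EFinB lee_fin.
have h : 1 <= d `^ (2 - alpha).
  have /(ler_powR (ltW d1)) : 0 <= 2 - alpha by move: a1; clear; lra.
  by rewrite powRr0.
by rewrite subr0 (le_trans h)// ler_peMl ?powR_ge0// ler1n.
Qed.

(** * Dimensions of a set that carries mass *)

Section Dimension.
Variables (R : realType) (p : nat).
Implicit Types (E U : set 'rV[R]_p) (s t d : R).

Definition cube_coverable s E := exists C : R, forall d, 0 < d <= 1 ->
  exists n (a : 'I_n -> 'rV[R]_p),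
    E `<=` \bigcup_i cube d (a i) /\ n%:R <= C * d `^ (- s).

(* The conclusion of the mass distribution principle, for covers by sets whose
   coordinate-wise diameter is at most [d k]. *)
Definition mass_bound s (c : R) E :=
  forall (U : nat -> set 'rV[R]_p) (d : nat -> R),
    (forall k, 0 <= d k <= 1) ->
    (forall k x y i, U k x -> U k y -> `|x 0 i - y 0 i| <= d k) ->
    E `<=` \bigcup_k U k -> (c%:E <= \sum_(0 <= k <oo) (d k `^ s)%:E)%E.

Definition has_mass s E := exists2 c : R, 0 < c & mass_bound s c E.

Lemma coord_le_eucl_dist (x y : 'rV[R]_p) i : `|x 0 i - y 0 i| <= eucl_dist x y.
Proof.
rewrite /eucl_dist -sqrtr_sqr ler_sqrt; last by apply: sumr_ge0 => j _; exact: sqr_ge0.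
by rewrite (bigD1 i)//= lerDl; apply: sumr_ge0 => j _; exact: sqr_ge0.
Qed.

Lemma eucl_dist_le (x y : 'rV[R]_p) d : 0 <= d ->
  (forall i, `|x 0 i - y 0 i| <= d) -> eucl_dist x y <= p%:R * d.
Proof.
move=> d0 xyd; rewrite /eucl_dist -[leRHS]ger0_norm ?mulr_ge0// -sqrtr_sqr.
rewrite ler_sqrt ?sqr_ge0// exprMn.
apply: (@le_trans _ _ (\sum_(i < p) d ^+ 2)).
  apply: ler_sum => i _; rewrite -[leLHS]ger0_norm ?sqr_ge0// normrX.
  by rewrite lerXn2r// nnegrE.
rewrite sumr_const card_ord -[d ^+ 2 *+ _]mulr_natl ler_wpM2r ?sqr_ge0//.
by rewrite -natrX ler_nat; case: (p) => // n; rewrite expnS expn1 leq_pmulr.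
Qed.

Lemma diameter_ge0 U : U !=set0 -> (0 <= diameter U)%E.
Proof.
move=> [x Ux]; apply: ereal_sup_ubound; exists x => //; exists x => //.
congr EFin; rewrite /eucl_dist big1 ?sqrtr0// => i _.
by rewrite subrr expr0n.
Qed.

Lemma diam_pow_ge0 s U : (0 <= diam_pow s U)%E.
Proof. by rewrite /diam_pow; case: ifP => // _; exact: poweR_ge0. Qed.

Lemma hausdorff_content_ge0 s d E : (0 <= hausdorff_content s d E)%E.
Proof.
apply: le_ereal_inf_tmp => _ [U _ <-].
by apply: nneseries_ge0 => k _ _; exact: diam_pow_ge0.
Qed.

(** For diameters at most 1 the power [s] is bounded by the power [t], so a mass bound for [s]
    passes to all smaller exponents. *)
Lemma hausdorff_content_mass s t E (c : R) : 0 < s -> 0 <= t <= s ->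
  mass_bound s c E ->
  (c%:E <= hausdorff_content t 1 E)%E.
Proof.
move=> s0 /andP[t0 ts] mass; apply: le_ereal_inf_tmp => _ [U [EU U1] <-].
(* The diameter of the empty set is [-oo]; the other diameters lie in [0, 1], so [fine] is faithful
   on them. *)
pose d k := if U k == set0 then 0 else fine (diameter (U k)).
have dP k : U k !=set0 -> diameter (U k) = (d k)%:E.
  move=> Uk; rewrite /d ifF; last by apply/negbTE/set0P.
  rewrite fineK// ge0_fin_numE ?diameter_ge0//.
  by rewrite (le_lt_trans (U1 k))// ltry.
have d01 k : 0 <= d k <= 1.
  have [Uk|/set0P Uk] := eqVneq (U k) set0; first by rewrite /d Uk eqxx lexx ler01.
  by rewrite -!lee_fin -dP// diameter_ge0// U1.
apply: (le_trans (mass U d d01 _ EU)).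
  move=> k x y i Ux Uy; rewrite (le_trans (coord_le_eucl_dist x y i))//.
  rewrite -lee_fin -dP; last by exists x.
  by apply: ereal_sup_ubound; exists x => //; exists y.
apply: lee_nneseries => k _; first by move=> _; rewrite lee_fin powR_ge0.
rewrite /diam_pow; have [Uk|/set0P Uk] := eqVneq (U k) set0.
  by rewrite /d Uk eqxx powR0 ?gt_eqF.
rewrite dP// poweR_EFin lee_fin.
have /andP[] := d01 k; rewrite le_eqVlt => /orP[/eqP <- _|dk0 dk1].
  by rewrite powR0 ?gt_eqF// powR_ge0.
by apply: ger_powR => //; rewrite dk0.
Qed.

Lemma finite_nneseries (f : nat -> \bar R) n : (forall k, (0 <= f k)%E) ->
  (forall k, (n <= k)%N -> f k = 0%E) ->
  (\sum_(0 <= k <oo) f k = \sum_(0 <= k < n) f k)%E.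
Proof.
move=> f0 fn; rewrite (nneseries_split 0 n) ?add0n// eseries0 ?adde0//.
by move=> i ni _; exact: fn.
Qed.

(** The finite cover is padded with empty sets, whose [diam_pow] is 0 even for [t = 0]. A cube of
    side [d] has Euclidean diameter at most [p%:R * d]. *)
Lemma hausdorff_content_cubes t d n (a : 'I_n -> 'rV[R]_p) E : 0 <= d -> 0 <= t ->
  E `<=` \bigcup_i cube d (a i) ->
  (hausdorff_content t (p%:R * d) E <= (n%:R * (p%:R * d) `^ t)%:E)%E.
Proof.
move=> d0 t0 Ea.
pose U k := if insub k is Some i then cube d (a i) else set0.
have Ud k : (diameter (U k) <= (p%:R * d)%:E)%E.
  apply: ge_ereal_sup => _ [x Ux [y Uy <-]]; rewrite lee_fin eucl_dist_le// => i.
  move: Ux Uy; rewrite /U; case: insub => // j /(_ i)/andP[x1 x2] /(_ i)/andP[y1 y2].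
  by rewrite ler_norml; apply/andP; split; lra.
apply: (@le_trans _ _ (\sum_(0 <= k <oo) diam_pow t (U k))%E).
  apply: ereal_inf_lbound; exists U => //; split => // x /Ea[i _ xi].
  by exists (i : nat) => //; rewrite /U valK.
rewrite (@finite_nneseries _ n).
- apply: (@le_trans _ _ (\sum_(0 <= k < n) ((p%:R * d) `^ t)%:E)%E); last first.
    by rewrite sumEFin lee_fin sumr_const_nat subn0 [leRHS]mulr_natl lexx.
  apply: lee_sum => k _; rewrite /diam_pow; case: ifPn => [_|/set0P Uk].
    by rewrite lee_fin powR_ge0.
  have := Ud k; have := diameter_ge0 Uk; case: (diameter (U k)) => // r.
  by rewrite poweR_EFin !lee_fin => r0 rd; rewrite ge0_ler_powR// nnegrE ?mulr_ge0.
- by move=> k; exact: diam_pow_ge0.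
- by move=> k nk; rewrite /diam_pow /U insubN ?eqxx// -leqNgt.
Qed.

(** The mass keeps the content at scale 1 positive for every exponent below [s]; for [t > s] the
    cube covers have sums of order [d] to the power [t - s], which tends to 0. *)
Lemma hausdorff_dim_eq s E : 0 < s -> cube_coverable s E -> has_mass s E ->
  hausdorff_dim E = s%:E.
Proof.
move=> s0 [C CP] [c c0 mass]; apply/eqP; rewrite eq_le; apply/andP; split; last first.
  apply: le_ereal_inf_tmp => _ [t [t0 Ht] <-]; rewrite lee_fin leNgt.
  apply/negP => ts; have : (c%:E <= hausdorff_measure t E)%E.
    apply: (@le_trans _ _ (hausdorff_content t 1 E)).
      by apply: hausdorff_content_mass mass; rewrite ?t0 ?ltW.
    by apply: ereal_sup_ubound; exists 1 => //=.
  by rewrite Ht lee_fin leNgt c0.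
suff H t : s < t -> hausdorff_measure t E = 0%E.
  apply/lee_addgt0Pr => e e0; rewrite -EFinD; apply: ereal_inf_lbound.
  by exists (s + e) => //; split; [rewrite addr_ge0 ?ltW|rewrite H// ltrDl].
move=> st; apply/eqP; rewrite eq_le; apply/andP; split; last first.
  apply: (le_trans (hausdorff_content_ge0 t 1 E)).
  by apply: ereal_sup_ubound; exists 1 => //=.
apply: ge_ereal_sup => _ [delta /= delta0 <-].
apply/lee_addgt0Pr => e e0; rewrite add0e.
pose K := `|C| * p%:R `^ t + 1.
have K0 : 0 < K by rewrite ltr_wpDl// mulr_ge0// powR_ge0.
(* The three terms ensure that the covering hypothesis applies, that the cubes have diameter at most
   [delta], and that the sum is at most [e]. *)
pose d := Num.min 1 (Num.min (delta / (p%:R + 1)) ((e / K) `^ (t - s)^-1)).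
have p1 : 0 < p%:R + 1 :> R by rewrite ltr_wpDl.
have d0 : 0 < d by rewrite !lt_min ltr01 divr_gt0// powR_gt0// divr_gt0.
have d1 : d <= 1 by rewrite ge_min lexx.
have dd : p%:R * d <= delta.
  apply: (@le_trans _ _ ((p%:R + 1) * d)); first by rewrite ler_wpM2r ?lerDl// ltW.
  by rewrite mulrC -ler_pdivlMr// !ge_min lexx orbT.
have de : K * d `^ (t - s) <= e.
  rewrite mulrC -ler_pdivlMr//.
  have ts0 : t - s != 0 by rewrite gt_eqF// subr_gt0.
  have eK0 : 0 <= e / K by rewrite ltW// divr_gt0.
  rewrite -[leRHS]powRr1// -(mulVf ts0) powRrM.
  by rewrite ge0_ler_powR ?nnegrE ?powR_ge0 ?subr_ge0 ?(ltW st) ?(ltW d0)// /d !ge_min lexx !orbT.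
have d01 : 0 < d <= 1 by rewrite d0.
have [n [a [Ea na]]] := CP d d01.
have t0 : 0 <= t by rewrite ltW// (lt_trans s0).
apply: (@le_trans _ _ (hausdorff_content t (p%:R * d) E)).
  apply: le_ereal_inf => _ [U [EU Ud] <-]; exists U => //; split => // k.
  by rewrite (le_trans (Ud k))// lee_fin.
apply: (le_trans (hausdorff_content_cubes (ltW d0) t0 Ea)); rewrite lee_fin.
apply: le_trans de.
rewrite powRM ?(ltW d0)//.
apply: (@le_trans _ _ (`|C| * d `^ (- s) * (p%:R `^ t * d `^ t))).
  rewrite ler_wpM2r ?mulr_ge0 ?powR_ge0// (le_trans na)//.
  by rewrite ler_wpM2r ?powR_ge0// ler_norm.
rewrite mulrACA -powRD; last by apply/implyP => _; rewrite gt_eqF.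
by rewrite addrC ler_wpM2r ?powR_ge0// lerDl.
Qed.

Lemma covering_number_le s E (C d : R) : 0 < d <= 1 ->
  (exists n (a : 'I_n -> 'rV[R]_p),
    E `<=` \bigcup_i cube d (a i) /\ n%:R <= C * d `^ (- s)) ->
  (covering_number d E <= (C * d `^ (- s))%:E)%E.
Proof.
move=> d01 [n [a [Ea na]]]; apply: (@le_trans _ _ (n%:R)%:E); last by rewrite lee_fin.
by apply: ereal_inf_lbound; exists n => //; exists a.
Qed.

(** The mass bound is applied to the cubes followed by empty sets of nominal diameter 0, which
    contribute nothing since [s > 0]. *)
Lemma covering_number_ge s E (c d : R) : 0 < s -> 0 < d <= 1 ->
  mass_bound s c E ->
  ((c * d `^ (- s))%:E <= covering_number d E)%E.
Proof.
move=> s0 /andP[d0 d1] mass; apply: le_ereal_inf_tmp => _ [n [a Ea] <-].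
pose U k := if insub k is Some i then cube d (a i) else set0.
pose dd k := if (k < n)%N then d else 0.
have := mass U dd; rewrite (@finite_nneseries _ n); first last.
- by move=> k; rewrite leqNgt /dd => /negbTE ->; rewrite powR0 ?gt_eqF.
- by move=> k; rewrite lee_fin powR_ge0.
rewrite lee_fin powRN ler_pdivrMr ?powR_gt0// => H.
have {H} : (c%:E <= \sum_(0 <= k < n) (dd k `^ s)%:E)%E.
  apply: H.
  - by move=> k; rewrite /dd; case: ifP; rewrite ?lexx ?ler01 ?(ltW d0).
  - move=> k x y i; rewrite /U /dd; case: insubP => // j -> _.
    move=> /(_ i)/andP[x1 x2] /(_ i)/andP[y1 y2].
    by rewrite ler_norml; apply/andP; split; lra.
  - by move=> x /Ea[i _ xi]; exists (i : nat) => //; rewrite /U valK.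
rewrite sumEFin lee_fin (eq_big_nat _ _ (F2 := fun=> d `^ s)).
  by rewrite sumr_const_nat subn0 mulr_natl.
by move=> i /andP[_ ni]; rewrite /dd ni.
Qed.

(** The covering number is [d] to the power [- s] up to the factors [c] and [C], so the quotient of
    logarithms differs from [s] by at most [M / (- ln d)]. *)
Lemma has_box_dim_eq s E : 0 < s -> cube_coverable s E -> has_mass s E ->
  has_box_dim E s%:E.
Proof.
move=> s0 [C CP] [c c0 mass].
have N1 d (d01 : 0 < d <= 1) := covering_number_le d01 (CP d d01).
have N2 d (d01 : 0 < d <= 1) := covering_number_ge s0 d01 mass.
have NE d : 0 < d <= 1 -> exists r, [/\ covering_number d E = r%:E,
    c * d `^ (- s) <= r & r <= C * d `^ (- s)].
  move=> d01; have := N1 d d01; have := N2 d d01.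
  by case: covering_number => // r; rewrite !lee_fin; exists r.
have C0 : 0 < C.
  have /NE[r [_ h1 h2]] : 0 < (1 : R) <= 1 by rewrite ltr01 lexx.
  by move: (le_trans h1 h2); rewrite powR1 !mulr1; exact: lt_le_trans.
pose g d := ln (fine (covering_number d E)) / - ln d.
have gE : \forall d \near (0 : R)^'+,
    (g d)%:E = (lne (covering_number d E) / (- ln d)%:E)%E.
  near=> d.
  have d0 : 0 < d by near: d; exact: nbhs_right_gt.
  have d1 : d < 1 by near: d; apply: nbhs_right_lt.
  have /NE[r [rE h1 _]] : 0 < d <= 1 by rewrite d0 ltW.
  have r0 : 0 < r by rewrite (lt_le_trans _ h1)// mulr_gt0// powR_gt0.
  rewrite /g rE /= leNgt r0 /= inver oppr_eq0 lt_eqF//.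
  by rewrite ln_lt0// d0.
rewrite /has_box_dim; apply: cvg_trans (near_eq_cvg gE) _.
apply: cvg_EFin; first by near=> d.
apply/cvgrPdist_le => e e0; rewrite /=.
pose M := `|ln c| + `|ln C|.
have M0 : 0 <= M by rewrite addr_ge0.
near=> d.
have d0 : 0 < d by near: d; exact: nbhs_right_gt.
have d1 : d < 1 by near: d; apply: nbhs_right_lt.
have dM : d < expR (- (M / e)) by near: d; apply: nbhs_right_lt; exact: expR_gt0.
have /NE[r [rE h1 h2]] : 0 < d <= 1 by rewrite d0 ltW.
have r0 : 0 < r by rewrite (lt_le_trans _ h1)// mulr_gt0// powR_gt0.
have l0 : 0 < - ln d by rewrite oppr_gt0 ln_lt0// d0.
have lM : M / e <= - ln d.
  by rewrite lerNr ltW// -[ltRHS]expRK ltr_ln// posrE expR_gt0.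
have ds0 : 0 < d `^ (- s) by rewrite powR_gt0.
move: h1 h2; rewrite -ler_ln ?posrE ?mulr_gt0// lnM ?posrE// ln_powR => h1.
rewrite -ler_ln ?posrE ?mulr_gt0// lnM ?posrE// ln_powR => h2.
rewrite /g rE /= -(ler_pM2r l0) -[X in `|_| * X](gtr0_norm l0) -normrM mulrBl divfK ?gt_eqF//.
have : M <= e * - ln d by rewrite mulrC -ler_pdivrMr.
apply: le_trans; rewrite ler_norml /M.
have := ler_norm (ln c); have := ler_norm (ln C).
have := ler_norm (- ln c); have := ler_norm (- ln C); rewrite !normrN.
have := normr_ge0 (ln c); have := normr_ge0 (ln C).
move=> *; apply/andP; split; lra.
Unshelve. all: by end_near.
Qed.

End Dimension.

(** * Graphs over the self-affine function *)

Lemma self_affine_holder (R : realType) (alpha x y : R) : 0 < alpha < 1 ->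
  0 <= x -> 0 <= y -> `|x - y| <= 1 ->
  `|self_affine (rate alpha) x - self_affine (rate alpha) y| <= 18 * `|x - y| `^ alpha.
Proof.
move=> ha x0 y0 xy1; have /andP[a0 a1] := ha.
have [->|xy] := eqVneq x y; first by rewrite subrr normr0 mulr_ge0 ?powR_ge0.
have d0 : 0 < `|x - y| by rewrite normr_gt0 subr_eq0.
have dd : 0 < `|x - y| <= 1 by rewrite d0.
have [n /andP[nd dn]] := pow3_scale dd.
apply: (le_trans (self_affine_near (rateS ha) x0 y0 dn)).
(* The 2 comes from [self_affine_near], one 3 from the floor in [rate], the other from rounding the
   distance to a power of 3. *)
have -> : 18 = 2 * (3 * 3) :> R by rewrite -!natrM.
rewrite -mulrA ler_pM2l//.
have q0 : 0 <= (3 : R) ^+ n by exact: ltW.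
have h1 : 3 ^- rate alpha n <= 3 * (3 ^- n) `^ alpha.
  rewrite powRVl// ler_pdivlMr ?powR_gt0// ler_pdivrMl//.
  by rewrite mulrC pow3_rate_ge.
apply: (le_trans h1); rewrite -mulrA ler_pM2l//.
apply: (@le_trans _ _ ((3 * `|x - y|) `^ alpha)).
  rewrite ge0_ler_powR ?(ltW a0)// ?nnegrE ?invr_ge0// ?mulr_ge0//.
  by move: nd; rewrite exprS invfM => /ltW; rewrite ler_pdivrMl.
rewrite powRM// ler_wpM2r ?powR_ge0// ler1_powR ?(ltW a1)//.
by rewrite ler1n.
Qed.

Lemma holder_cube_coverable (R : realType) (alpha C : R) (G : R -> R) :
  0 < alpha < 1 -> 0 <= C ->
  (forall x y, 0 <= x <= 1 -> 0 <= y <= 1 -> `|G x - G y| <= C * `|x - y| `^ alpha) ->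
  cube_coverable (2 - alpha) (graph (fun x : unit_interval R => G (ui_val x))).
Proof.
(* There are [M <= 2 / d] columns, and the number [K] of cubes in each is at most [2 * C + 1] times
   [d] to the power [alpha - 1]. *)
move=> /andP[a0 a1] C0 hG; exists (2 * (2 * C + 1)) => d /andP[d0 d1].
pose M := (Num.truncn (1 / d)).+1.
pose K := (Num.truncn (2 * C * d `^ alpha / d)).+1.
have dneq : d != 0 by rewrite gt_eqF.
(* Cube [i] is number [i %% K] in column [i %/ K]. A column starts at the lowest value that the
   Hoelder bound allows from its left end. *)
exists (M * K)%N, (fun i : 'I_(M * K) => \row_(j < 2)
  (if j == 0 then (i %/ K)%N%:R * d
   else G ((i %/ K)%N%:R * d) - C * d `^ alpha + (i %% K)%N%:R * d)).
split.
  move=> _ [x _ <-]; set z := ui_val x.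
  have z01 : 0 <= z <= 1 by have := valP x; rewrite inE /= in_itv.
  have /andP[z0 z1] := z01.
  pose j := Num.truncn (z / d).
  have /andP[j1 j2] : j%:R <= z / d < j.+1%:R by rewrite truncn_itv// divr_ge0// ltW.
  have jM : (j < M)%N by rewrite ltnS le_truncn// ler_wpM2r// invr_ge0 ltW.
  have j1' : j%:R * d <= z by rewrite -ler_pdivlMr.
  have j2' : z <= j%:R * d + d.
    by move: j2; rewrite ltr_pdivrMr// -natr1 mulrDl mul1r => /ltW.
  have jd0 : 0 <= j%:R * d by rewrite mulr_ge0// ltW.
  have Gz : `|G z - G (j%:R * d)| <= C * d `^ alpha.
    apply: (le_trans (hG _ _ z01 _)); first by rewrite jd0 (le_trans j1').
    rewrite ler_wpM2l// ge0_ler_powR ?nnegrE ?(ltW a0) ?(ltW d0)//.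
    by rewrite ger0_norm ?subr_ge0// lerBlDl.
  pose w := G z - G (j%:R * d) + C * d `^ alpha.
  have /andP[w1 w2] : 0 <= w <= 2 * C * d `^ alpha.
    move: Gz; rewrite ler_norml /w => /andP[h1 h2].
    by rewrite -mulrA; apply/andP; split; lra.
  pose l := Num.truncn (w / d).
  have /andP[l1 l2] : l%:R <= w / d < l.+1%:R by rewrite truncn_itv// divr_ge0// ltW.
  have lK : (l < K)%N by rewrite ltnS le_truncn// ler_wpM2r// invr_ge0 ltW.
  have l1' : l%:R * d <= w by rewrite -ler_pdivlMr.
  have l2' : w <= l%:R * d + d.
    by move: l2; rewrite ltr_pdivrMr// -natr1 mulrDl mul1r => /ltW.
  have ilt : (j * K + l < M * K)%N.
    by rewrite (@leq_trans (j.+1 * K))// ?leq_mul2r ?jM ?orbT// mulSn addnC ltn_add2r.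
  exists (Ordinal ilt) => // i; rewrite !mxE /=.
  have -> : ((j * K + l) %/ K = j)%N by rewrite divnMDl// divn_small ?addn0.
  have -> : ((j * K + l) %% K = l)%N by rewrite modnMDl modn_small.
  case: ifP => _; first by rewrite j1'.
  by move: l1' l2'; rewrite /w => h1 h2; apply/andP; split; lra.
have dpow : d `^ alpha / d = d `^ (alpha - 1).
  by rewrite powRB ?powRr1 ?(ltW d0)//; apply/implyP.
have M1 : M%:R <= 2 / d.
  have id1 : 1 <= d^-1 by rewrite invf_ge1.
  rewrite /M -natr1 (_ : 2 / d = 1 / d + d^-1); last by field.
  by rewrite lerD// truncn_le mul1r invr_ge0 ltW.
have K1 : K%:R <= (2 * C + 1) * d `^ (alpha - 1).
  rewrite /K -natr1 -[2 * C * _ / d]mulrA dpow.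
  rewrite (mulrDl (2 * C)) mul1r lerD//.
    by rewrite truncn_le !mulr_ge0// powR_ge0.
  have dd : 0 < d <= 1 by rewrite d0.
  have /(ger_powR dd) : alpha - 1 <= 0 by rewrite subr_le0 ltW.
  by rewrite powRr0.
rewrite natrM; apply: le_trans (ler_pM _ _ M1 K1) _ => //.
rewrite [leLHS](_ : _ = 2 * (2 * C + 1) * (d `^ (alpha - 1) / d)); last by field.
rewrite ler_wpM2l ?mulr_ge0 ?addr_ge0 ?mulr_ge0//.
rewrite -[X in _ / X]powRr1 ?(ltW d0)// -powRB; last by apply/implyP.
by rewrite (_ : alpha - 1 - 1 = - (2 - alpha))//; ring.
Qed.

(** The mass is the Lebesgue measure of the projection to the first axis: the projections of the
    covering sets cover [[p, q]], and [level_set] bounds the measure of each. *)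
Lemma self_affine_has_mass (R : realType) (alpha c p q : R) (G : R -> R) :
  0 < alpha < 1 -> 0 < c <= 1 -> 0 <= p -> p < q -> q <= 1 ->
  (forall x y, p <= x <= q -> p <= y <= q ->
     c * `|self_affine (rate alpha) x - self_affine (rate alpha) y| <= `|G x - G y|) ->
  has_mass (2 - alpha) (graph (fun x : unit_interval R => G (ui_val x))).
Proof.
move=> ha /andP[c0 c1] p0 pq q1 hG; have /andP[a0 a1] := ha.
have cs0 : 0 < 225 / c `^ (2 - alpha) by rewrite divr_gt0// powR_gt0.
exists ((q - p) / (225 / c `^ (2 - alpha))); first by rewrite divr_gt0// subr_gt0.
move=> U d d01 Ud gU.
pose pt x := \row_(j < 2) (if j == 0 then x else G x).
pose E k := [set x | p <= x <= q /\ U k (pt x)].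
have levk k : exists W, [/\ measurable W, E k `<=` W &
    (lebesgue_measure W <= (225 * (d k / c) `^ (2 - alpha))%:E)%E].
  have /andP[dk0 dk1] := d01 k.
  (* Since [c <= 1], the scale [d k / c] bounds the variation of both [x] and the self-affine
     function. *)
  apply: level_set => //.
  - by rewrite divr_ge0// ltW.
  - by move=> x [/andP[px xq] _]; rewrite (le_trans p0 px) (le_trans xq q1).
  - move=> x y [xI Ux] [yI Uy]; split.
      have := Ud k _ _ 0 Ux Uy; rewrite !mxE /= => /le_trans; apply.
      by rewrite ler_peMr// invf_ge1.
    rewrite ler_pdivlMr// mulrC (le_trans (hG _ _ xI yI))//.
    by have := Ud k _ _ 1 Ux Uy; rewrite !mxE.
have [W WP] := choice levk.
have : ((q - p)%:E <= \sum_(0 <= k <oo) lebesgue_measure (W k))%E.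
  have -> : (q - p)%:E = lebesgue_measure (`[p, q]%classic : set R).
    by rewrite lebesgue_measure_itv /= lte_fin pq EFinB.
  apply: measure_sigma_subadditive => //; first by move=> k; have [] := WP k.
  move=> x /=; rewrite in_itv /= => xI; have /andP[px xq] := xI.
  have x01 : x \in (`[0, 1]%classic : set R).
    by rewrite inE /= in_itv /= (le_trans p0 px) (le_trans xq q1).
  have /gU[k _ Uk] : graph (fun x : unit_interval R => G (ui_val x)) (pt x).
    by exists (exist _ x x01).
  by exists k => //; have [_ EW _] := WP k; apply: EW.
move=> /le_trans /(_ (lee_nneseries (v := fun k =>
  ((225 / c `^ (2 - alpha))%:E * (d k `^ (2 - alpha))%:E)%E) _ _)).
rewrite nneseriesZl//; last by move=> k _; rewrite lee_fin powR_ge0.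
move=> H; rewrite EFinM muleC -lee_pdivlMl ?invr_gt0// invrK.
apply: H.
- by move=> k _ _; exact: measure_ge0.
- move=> k _; have [_ _ /le_trans] := WP k; apply.
  have /andP[dk0 _] := d01 k.
  rewrite -EFinM lee_fin powRM ?invr_ge0 ?(ltW c0)// powRVl ?(ltW c0)//.
  by rewrite mulrCA mulrC -mulrA mulrCA mulrA mulrAC lexx.
Qed.

(** A triadic interval of length [3 ^- m] fits strictly inside [(u, v)]. At a level [N] with
    [rate alpha N = m] it is the image interval of some cell. *)
Lemma self_affine_hit (R : realType) (alpha u v : R) : 0 < alpha < 1 ->
  0 <= u -> u < v -> v <= 1 ->
  exists p q, [/\ 0 <= p, p < q, q <= 1 &
    forall x, p <= x <= q -> u < self_affine (rate alpha) x < v].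
Proof.
move=> ha u0 uv v1.
have [m mv] : exists m, 3 ^- m < (v - u) / 2.
  have vu : 0 < Num.min 1 ((v - u) / 2) <= 1.
    by rewrite lt_min ltr01 divr_gt0 ?subr_gt0// ge_min lexx.
  have [n /andP[+ _]] := pow3_scale vu; rewrite lt_min => /andP[_ h].
  by exists n.+1.
have [N _ kN] := rate_onto ha m.
have m0 : 0 < (3 : R) ^+ m by [].
have N0 : 0 < (3 : R) ^+ N by [].
pose b := (Num.truncn (3 ^+ m * u)).+1.
have /andP[b1 b2] : (Num.truncn (3 ^+ m * u))%:R <= 3 ^+ m * u < b%:R.
  by rewrite truncn_itv// mulr_ge0// ltW.
have b3 : b%:R <= 3 ^+ m * u + 1 by rewrite /b -natr1 lerD2r.
have ub : u < b%:R / 3 ^+ m by rewrite ltr_pdivlMr// mulrC.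
have bv : b%:R / 3 ^+ m + 3 ^- m < v.
  have : b%:R / 3 ^+ m <= u + 3 ^- m by rewrite ler_pdivrMr// mulrDl mulVf ?gt_eqF// [u * _]mulrC.
  by move: mv; move: (3 ^- m) (b%:R / _) => e f; clear; lra.
have bm : (b < 3 ^ rate alpha N)%N.
  rewrite kN -(ltr_nat R) natrX -[ltRHS]mul1r -ltr_pdivrMr//.
  by rewrite (lt_le_trans _ v1)// (le_lt_trans _ bv)// lerDl invr_ge0 ltW.
have [x [x0 x1 xb]] := self_affine_onto R (rateS ha) (rate0 alpha) bm.
pose a := cell_index N x.
have /andP[ax xa] := cell_index_itv N x0.
have aN : (a < 3 ^ N)%N.
  by rewrite -(ltr_nat R) natrX (le_lt_trans ax)// -[ltRHS]mulr1 ltr_pM2l.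
(* Only the left half of the cell is kept, because its right end belongs to the next cell. *)
exists (a%:R / 3 ^+ N), ((a%:R + 1 / 2) / 3 ^+ N); split.
- by rewrite divr_ge0// ltW.
- by rewrite ltr_pM2r ?invr_gt0// ltrDl divr_gt0.
- rewrite ler_pdivrMr// [1 * 3 ^+ N]mul1r.
  move: aN; rewrite -(ler_nat R) natrX -natr1 => /(le_trans _); apply.
  by rewrite lerD2l; lra.
move=> y; rewrite ler_pdivrMr// ler_pdivlMr// => /andP[y1 y2].
have y0 : 0 <= y by rewrite -(pmulr_lge0 _ N0) (le_trans _ y1).
have ya : cell_index N y = a.
  apply: truncn_def; rewrite mulrC y1 (le_lt_trans y2)// -[a.+1%:R]natr1 ltrD2l; lra.
have := self_affine_itv (rateS ha) N y0.
rewrite /cell_low ya; move: xb; rewrite /cell_low -/a => ->; rewrite kN => /andP[h1 h2].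
by rewrite (lt_le_trans ub)// (le_lt_trans h2).
Qed.

(** * Integrally independent reals *)

Section IndependentReals.
Variable R : realType.
Implicit Types t : R.

(* [indep t] has binary digits at the squares of the codes of the finite prefixes
   of [t].  Distinct reals share finitely many prefixes, and the gaps between
   squares grow, so an integral relation must hold digit by digit far enough out. *)
Definition prefix_code n t : nat :=
  (2 ^ n * (pickle (Num.floor (2 ^+ n * t))).*2.+1)%N.

(** The cofactor in [prefix_code] is odd, so the 2-adic valuation of a code recovers the prefix
    length. *)
Definition in_code k t : bool := k == prefix_code (logn 2 k) t.

Definition weight k : R := 2 ^- (k ^ 2).

Definition partial_indep m t : R := \sum_(k < m) (in_code k t)%:R * weight k.

Definition indep t : R := sup (range (partial_indep ^~ t)).

Lemma logn_prefix_code n t : logn 2 (prefix_code n t) = n.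
Proof.
rewrite lognM ?expn_gt0// lognX logn_prime// eqxx muln1.
by rewrite logn_coprime ?addn0// coprime2n /= odd_double.
Qed.

Lemma in_prefix_code n s t :
  in_code (prefix_code n s) t = (Num.floor (2 ^+ n * s) == Num.floor (2 ^+ n * t)).
Proof.
rewrite /in_code logn_prefix_code /prefix_code eqn_pmul2l ?expn_gt0//.
by rewrite eqSS -!muln2 eqn_pmul2r// (inj_eq (pcan_inj pickleK)).
Qed.

Lemma leq_prefix_code n t : (n <= prefix_code n t)%N.
Proof. by rewrite (leq_trans (ltnW (ltn_expl n (ltnSn 1))))// leq_pmulr. Qed.

(** Equal floors put the scaled numbers at distance less than 1, which is impossible once [2 ^ n]
    reaches the inverse of the distance of [s] and [t]. *)
Lemma floor_separate s t : s != t -> exists N, forall n, (N <= n)%N ->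
  Num.floor (2 ^+ n * s) != Num.floor (2 ^+ n * t).
Proof.
move=> st; have d0 : 0 < `|s - t| by rewrite normr_gt0 subr_eq0.
exists (Num.truncn `|s - t|^-1).+1 => n Nn; apply/eqP => E.
have n0 : 0 < (2 : R) ^+ n by rewrite exprn_gt0.
have : `|2 ^+ n * s - 2 ^+ n * t| < 1.
  have := floor_itv (2 ^+ n * s); have := floor_itv (2 ^+ n * t).
  rewrite E intrD mulr1z => /andP[h1 h2] /andP[h3 h4].
  by rewrite ltr_norml; move: h1 h2 h3 h4; move: (2 ^+ n * s) (2 ^+ n * t) ((Num.floor _)%:~R : R) => a b c;
    clear; lra.
rewrite -mulrBr normrM (gtr0_norm n0) -ltr_pdivlMr// mul1r.
apply/negP; rewrite -leNgt.
apply: (le_trans (ltW (truncnS_gt _))).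
by rewrite -natrX ler_nat (leq_trans Nn)// ltnW// ltn_expl.
Qed.

Lemma weight_gt0 k : 0 < weight k.
Proof. by rewrite invr_gt0 exprn_gt0. Qed.

Lemma weightS k : weight k = 2 ^+ (k.*2.+1) * weight k.+1.
Proof.
rewrite /weight (_ : k.+1 ^ 2 = k ^ 2 + k.*2.+1)%N; last by rewrite -muln2; clear; lia.
by rewrite exprD; field; rewrite !expf_neq0.
Qed.

Lemma weightS_le k : 2 * weight k.+1 <= weight k.
Proof.
rewrite [leRHS]weightS exprS -mulrA ler_pM2l// ler_peMl ?(ltW (weight_gt0 _))//.
by rewrite exprn_ege1// ler1n.
Qed.

Lemma partial_indepS m t :
  partial_indep m.+1 t = partial_indep m t + (in_code m t)%:R * weight m.
Proof. by rewrite /partial_indep big_ord_recr. Qed.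

Lemma partial_indep_itv m n t : (m <= n)%N ->
  partial_indep m t <= partial_indep n t <= partial_indep m t + 2 * weight m.
Proof.
move=> /subnKC <-; set j := (n - m)%N.
(* Subtracting the remaining tail bound strengthens the claim enough for induction. *)
suff : partial_indep m t <= partial_indep (m + j) t
    <= partial_indep m t + 2 * weight m - 2 * weight (m + j).
  by move=> /andP[-> /le_trans]/=; apply; rewrite gerBl mulr_ge0// ltW// weight_gt0.
elim: j => [|j /andP[h1 h2]]; first by rewrite addn0 addrK lexx.
have w0 := weight_gt0 (m + j); have := weightS_le (m + j).
rewrite addnS partial_indepS; case: in_code => /=; rewrite ?mul1r ?mul0r.
  move: h1 h2 w0; move: (weight _) (weight (m + j)) (weight (_.+1)) => a b c;
  move: (partial_indep _ _) (partial_indep _ _) => d e; clear => *; apply/andP; split; lra.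
move: h1 h2 w0; move: (weight _) (weight (m + j)) (weight (_.+1)) => a b c;
move: (partial_indep _ _) (partial_indep _ _) => d e; clear => *; apply/andP; split; lra.
Qed.

Lemma indep_itv m t :
  partial_indep m t <= indep t <= partial_indep m t + 2 * weight m.
Proof.
have ub : ubound (range (partial_indep ^~ t)) (partial_indep m t + 2 * weight m).
  move=> _ [n _ <-]; have [mn|/ltnW nm] := leqP m n.
    by have /andP[] := partial_indep_itv t mn.
  have /andP[h _] := partial_indep_itv t nm.
  by rewrite (le_trans h)// lerDl mulr_ge0// ltW// weight_gt0.
apply/andP; split; last by apply: ge_sup => //; exists (partial_indep m t), m.
apply: sup_upper_bound; last by exists m.
by split; [exists (partial_indep m t), m | eexists; exact: ub].
Qed.

Lemma indep_gt0 t : 0 < indep t.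
Proof.
have /andP[+ _] := indep_itv (prefix_code 0 t).+1 t; apply: lt_le_trans.
rewrite partial_indepS in_prefix_code eqxx mul1r ltr_wpDl ?weight_gt0//.
by apply: sumr_ge0 => k _; rewrite mulr_ge0// ltW// weight_gt0.
Qed.

(** With this, an integral combination of truncations is either 0 or at least [weight m] in absolute
    value. *)
Lemma partial_indep_nat m t : exists a : nat, partial_indep m.+1 t = a%:R * weight m.
Proof.
elim: m => [|m [a IH]].
  by exists (in_code 0 t); rewrite partial_indepS /partial_indep big_ord0 add0r.
exists (a * 2 ^ (m.*2.+1) + in_code m.+1 t)%N.
by rewrite partial_indepS IH weightS natrD natrM natrX mulrDl mulrA.
Qed.

Lemma indep_independent n (t : 'I_n -> R) (z : 'I_n -> int) : injective t ->
  \sum_(i < n) (z i)%:~R * indep (t i) = 0 -> forall i, z i = 0.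
Proof.
move=> t_inj z0.
pose C : nat := (\sum_(i < n) `|z i|)%N.
(* The truncated relation is an integral multiple of [weight m], while the tails add up to at most
   [C * (2 * weight m.+1) < weight m]. *)
have vanish m : (C <= m)%N -> \sum_(i < n) (z i)%:~R * partial_indep m.+1 (t i) = 0.
  move=> Cm.
  have [a aP] := choice (fun i => partial_indep_nat m (t i)).
  pose s : int := \sum_(i < n) z i * (a i)%:Z.
  have sE : \sum_(i < n) (z i)%:~R * partial_indep m.+1 (t i) = s%:~R * weight m.
    rewrite /s rmorph_sum /= mulr_suml; apply: eq_bigr => i _.
    by rewrite aP intrM mulrA.
  rewrite sE; suff -> : s = 0 by rewrite mul0r.
  apply/eqP; rewrite -absz_eq0 -leqn0 -ltnS -(ltr_nat R) natr_absz intr_norm.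
  have w0 := weight_gt0 m.
  rewrite -(ltr_pM2r w0) mul1r -{1}(gtr0_norm w0) -normrM -sE.
  have -> : \sum_(i < n) (z i)%:~R * partial_indep m.+1 (t i) =
      \sum_(i < n) ((z i)%:~R * partial_indep m.+1 (t i) - (z i)%:~R * indep (t i)).
    by rewrite sumrB z0 subr0.
  apply: (le_lt_trans (ler_norm_sum _ _ _)).
  apply: (@le_lt_trans _ _ (\sum_(i < n) (`|z i|%N)%:R * (2 * weight m.+1))).
    apply: ler_sum => i _; rewrite -mulrBr normrM natr_absz intr_norm.
    rewrite ler_wpM2l//.
    have /andP[h1 h2] := indep_itv m.+1 (t i).
    have w1 := weight_gt0 m.+1.
    rewrite ler_norml; move: h1 h2 w1; move: (weight _) (indep _) (partial_indep _ _) => b c d.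
    by clear => *; apply/andP; split; lra.
  rewrite -mulr_suml -natr_sum -/C [weight m]weightS exprS -!mulrA mulrCA ltr_pM2l//.
  rewrite ltr_pM2r ?weight_gt0// -natrX ltr_nat.
  rewrite (leq_ltn_trans Cm)// (leq_ltn_trans _ (ltn_expl _ _))// -addnn leq_addr//.
(* The difference of two consecutive truncated relations isolates one digit. *)
have digit m : (C < m)%N -> \sum_(i < n) z i * (in_code m (t i))%:Z = 0.
  case: m => // m Cm.
  have := vanish m.+1 (leq_trans Cm (leqnSn _)).
  under eq_bigr do rewrite partial_indepS mulrDr.
  rewrite big_split /= vanish// add0r.
  under eq_bigr do rewrite mulrA.
  rewrite -mulr_suml => /eqP; rewrite mulf_eq0 (gt_eqF (weight_gt0 _)) orbF => /eqP s0.
  apply/eqP; rewrite -(intr_eq0 R) rmorph_sum /=.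
  by apply/eqP; rewrite -[RHS]s0; apply: eq_bigr => i _; rewrite intrM.
move=> i.
have [N NP] : exists N : 'I_n -> nat, forall j, j != i -> forall l, (N j <= l)%N ->
    Num.floor (2 ^+ l * t i) != Num.floor (2 ^+ l * t j).
  suff H j : exists N : nat, j != i -> forall l, (N <= l)%N ->
    Num.floor (2 ^+ l * t i) != Num.floor (2 ^+ l * t j).
    by have [N NP] := choice H; exists N.
  have [->|ji] := eqVneq j i; first by exists 0%N.
  have /floor_separate[N NP] : t i != t j.
    by apply: contraNneq ji => /t_inj ->.
  by exists N.
(* At this length the prefix of [t i] differs from those of all other [t j], so the digit at its
   code involves [z i] alone. *)
pose l := (C.+1 + \max_(j < n) N j)%N.
have Cl : (C < prefix_code l (t i))%N.
  by rewrite (leq_trans _ (leq_prefix_code _ _))// /l leq_addr.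
have := digit _ Cl; rewrite (bigD1 i)//= in_prefix_code eqxx mulr1 big1 ?addr0// => j ji.
rewrite in_prefix_code (negbTE (NP j ji _ _)) ?mulr0//.
by rewrite /l (leq_trans (leq_bigmax j))// leq_addl.
Qed.

Lemma indep_inj : injective indep.
Proof.
move=> t t' tE; apply: contrapT => /eqP tt'.
pose u (i : 'I_2) := nth 0 [:: t; t'] i.
pose z (i : 'I_2) := nth (0 : int) [:: 1; -1] i.
have u_inj : injective u.
  move=> i j /eqP; rewrite /u nth_uniq//= ?inE ?tt'// => /eqP; exact: val_inj.
have := indep_independent (z := z) u_inj; rewrite big_ord_recl big_ord1 /u /z /=.
by rewrite tE mulr1z mulrN1z mul1r mulN1r subrr => /(_ erefl 0).
Qed.

End IndependentReals.

(** * Exponential sums *)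

Section ExpSums.
Variable R : realType.
Implicit Types (s : seq R) (c : R -> R).

Definition exp_sum s c (y : R) : R := \sum_(g <- s) c g * expR (g * y).

(* [h (y + e) - expR (g0 * e) * h y] has one exponential less than [h]. *)
Lemma exp_sum_eq0 s c (u v : R) : uniq s -> u < v ->
  (forall y, u < y < v -> exp_sum s c y = 0) -> forall g, g \in s -> c g = 0.
Proof.
elim: s c u v => [|g0 s IH] //= c u v /andP[g0s us] uv h0.
(* With half the length as shift, [y] and [y + e] both stay in [(u, v)] for [y] in [(u, u + e)]. *)
pose e := (v - u) / 2.
have e0 : 0 < e by rewrite divr_gt0// subr_gt0.
have uev : u + e + e = v by rewrite /e; field.
have cs g : g \in s -> c g = 0.
  move=> gs; apply/eqP.
  have := IH (fun g => c g * (expR (g * e) - expR (g0 * e))) u (u + e) us.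
  suff : forall y, u < y < u + e ->
      exp_sum s (fun g => c g * (expR (g * e) - expR (g0 * e))) y = 0.
    rewrite ltrDl e0 => h /(_ isT h _ gs)/eqP.
    rewrite mulf_eq0 subr_eq0 => /orP[//|/eqP/expR_inj].
    move=> /(mulIf (lt0r_neq0 e0)) gg0.
    by move: g0s; rewrite -gg0 gs.
  move=> y /andP[y1 y2].
  have hy : exp_sum (g0 :: s) c y = 0.
    by apply: h0; rewrite y1 -uev (lt_trans y2)// ltrDl.
  have hye : exp_sum (g0 :: s) c (y + e) = 0.
    by apply: h0; rewrite -uev ltrD2r y2 (lt_trans y1)// ltrDl.
  have <- : exp_sum (g0 :: s) c (y + e) - expR (g0 * e) * exp_sum (g0 :: s) c y = 0.
    by rewrite hy hye mulr0 subr0.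
  rewrite /exp_sum !big_cons [g0 * (y + e)]mulrDr expRD.
  rewrite (_ : forall a b d p q : R, a * (b * d) + p - d * (a * b + q) = p - d * q); last first.
    by move=> *; ring.
  rewrite mulr_sumr -sumrB; apply: eq_bigr => g1 _.
  by rewrite [g1 * (y + e)]mulrDr expRD; ring.
move=> g; rewrite inE => /orP[/eqP ->|]; last exact: cs.
have := h0 (u + e); rewrite -uev !ltrDl e0 => /(_ isT)/eqP.
rewrite /exp_sum big_cons big_seq big1 ?addr0 => [|g1 /cs ->]; last by rewrite mul0r.
by rewrite mulf_eq0 (gt_eqF (expR_gt0 _)) orbF => /eqP.
Qed.

Lemma is_derive_exp_sum s c (y : R) :
  is_derive y (1 : R) (exp_sum s c) (exp_sum s (fun g => c g * g) y).
Proof.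
elim: s => [|g s IH].
  rewrite (_ : exp_sum [::] c = cst 0); last by apply/funext => x; rewrite /exp_sum big_nil.
  by rewrite /exp_sum big_nil; exact: is_derive_cst.
rewrite (_ : exp_sum (g :: s) c = (fun x => c g * expR (g * x)) \+ exp_sum s c); last first.
  by apply/funext => x; rewrite /exp_sum big_cons.
have d1 : is_derive y (1 : R) (fun x => c g * expR (g * x)) (c g * (expR (g * y) * g)).
  apply: is_deriveZ.
  have gd : is_derive y (1 : R) (fun x : R => g * x) g.
    by have := is_deriveZ g (is_derive_id y (1 : R)); rewrite /GRing.scale /= mulr1.
  exact: (is_derive1_comp (is_derive_expR _) gd).
apply: is_derive_eq.
by rewrite /exp_sum big_cons [expR _ * g]mulrC mulrA.
Qed.

Lemma continuous_exp_sum s c : continuous (exp_sum s c).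
Proof.
move=> y; have [d _] := is_derive_exp_sum s c y.
by apply: differentiable_continuous; apply/derivable1_diffP.
Qed.

Lemma exp_sum_mvt s c (x y : R) : x <= y -> exists2 z, x <= z <= y &
  exp_sum s c y - exp_sum s c x = exp_sum s (fun g => c g * g) z * (y - x).
Proof.
move=> xy; have [||z zxy ->] := @MVT_segment R (exp_sum s c)
  (exp_sum s (fun g => c g * g)) x y xy.
- by move=> z _; exact: is_derive_exp_sum.
- by apply: continuous_subspaceT => z; exact: continuous_exp_sum.
- by exists z => //; move: zxy; rewrite in_itv.
Qed.

Lemma exp_sum_lipschitz s c (b : R) : exists2 L : R, 0 <= L &
  forall x y, 0 <= x <= b -> 0 <= y <= b ->
    `|exp_sum s c x - exp_sum s c y| <= L * `|x - y|.
Proof.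
pose L := \sum_(g <- s) `|c g * g| * expR (`|g| * b).
exists L; first by apply: sumr_ge0 => g _; rewrite mulr_ge0// expR_ge0.
move=> x y; wlog xy : x y / x <= y => [H x01 y01|].
  have /orP[xy|xy] := le_total x y; first exact: H.
  by rewrite distrC [`|x - y|]distrC; exact: H.
move=> /andP[x0 x1] /andP[y0 y1].
have [z /andP[z1 z2] h] := exp_sum_mvt s c xy.
rewrite distrC h normrM [`|x - y|]distrC ler_wpM2r//.
apply: (le_trans (ler_norm_sum _ _ _)); apply: ler_sum => g _.
rewrite normrM ler_wpM2l// (ger0_norm (expR_ge0 _)) ler_expR.
rewrite (le_trans (ler_norm _))// normrM ler_wpM2l// ger0_norm.
  by rewrite (le_trans z2).
by rewrite (le_trans x0).
Qed.

(** The derivative is the exponential sum with coefficients [c g * g], so by [exp_sum_eq0] it is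
    nonzero somewhere in [(u, v)]. Near such a point it keeps half its size, and the mean value
    theorem applies. *)
Lemma exp_sum_expanding s c (g u v : R) : uniq s -> g \in s -> g != 0 -> c g != 0 ->
  u < v -> exists u' v' e, [/\ u <= u', u' < v', v' <= v, 0 < e &
    forall x y, u' < x < v' -> u' < y < v' ->
      e * `|x - y| <= `|exp_sum s c x - exp_sum s c y|].
Proof.
move=> us gs g0 cg0 uv.
pose dh := exp_sum s (fun g => c g * g).
have [y0 [/andP[uy yv] dy0]] : exists y0, u < y0 < v /\ dh y0 != 0.
  apply: contrapT => H; move: (mulf_neq0 cg0 g0).
  rewrite (exp_sum_eq0 (c := fun g => c g * g) us uv _ gs) ?eqxx// => y yuv.
  by apply/eqP; apply: contrapT => /negP dy; apply: H; exists y.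
have dpos : 0 < `|dh y0| / 2 by rewrite divr_gt0// normr_gt0.
have /cvgrPdist_lt /(_ _ dpos) := @continuous_exp_sum s (fun g => c g * g) y0.
move=> /nbhs_ballP[r /= r0 rP].
pose u' := Num.max u (y0 - r); pose v' := Num.min v (y0 + r).
exists u', v', (`|dh y0| / 2); split => //.
- by rewrite le_max lexx.
- rewrite gt_max !lt_min uv /=; move: uy yv r0; clear => *.
  by apply/andP; split; [|apply/andP; split]; lra.
- by rewrite ge_min lexx.
move=> x y; wlog xy : x y / x <= y => [H xI yI|].
  have /orP[xy|xy] := le_total x y; first exact: H.
  by rewrite distrC [leRHS]distrC; exact: H.
rewrite !gt_max !lt_min => /andP[/andP[_ x1] _] /andP[_ /andP[_ y1]].
have [z /andP[z1 z2] h] := exp_sum_mvt s c xy.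
rewrite distrC [leRHS]distrC h normrM ler_wpM2r//.
have : ball y0 r z.
  rewrite /ball /= ltr_norml; move: x1 y1 z1 z2; clear => *; apply/andP; split; lra.
move=> /rP; rewrite -/dh /=.
have := ler_normD (dh y0 - dh z) (dh z); rewrite subrK.
by move: (`|dh y0|) (`|dh z|) (`|_ - _|) => A B D; clear; lra.
Qed.

End ExpSums.

(** * Algebrability *)

(** The bound is 2 because [x = 1] lies in the cell of index 1 at level 0. *)
Lemma self_affine_range (R : realType) (alpha x : R) : 0 < alpha < 1 ->
  0 <= x <= 1 -> 0 <= self_affine (rate alpha) x <= 2.
Proof.
move=> ha /andP[x0 x1]; have := self_affine_itv (rateS ha) 0 x0.
rewrite /cell_low rate0 expr0 invr1 mulr1 /= => /andP[h1 h2].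
rewrite (le_trans _ h1)//= (le_trans h2)// (_ : 2 = 1 + 1)// lerD2r.
have /andP[h _] := cell_index_itv 0 x0.
by rewrite (le_trans h)// expr0 mul1r.
Qed.

Lemma dist_unit_itv (R : realType) (x y : R) :
  0 <= x <= 1 -> 0 <= y <= 1 -> `|x - y| <= 1.
Proof.
by move=> /andP[? ?] /andP[? ?]; rewrite ler_norml; apply/andP; split; lra.
Qed.

Lemma ui_val01 (R : realType) (x : unit_interval R) : 0 <= ui_val x <= 1.
Proof. by have := valP x; rewrite inE /= in_itv. Qed.

Section ExpSumsOfSelfAffine.
Variables (R : realType) (alpha : R).
Hypothesis ha : 0 < alpha < 1.
Variables (s : seq R) (c : R -> R) (g : R).
Hypotheses (us : uniq s) (gs : g \in s) (g0 : g != 0) (cg0 : c g != 0).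

Definition exp_sum_graph (x : unit_interval R) : R :=
  exp_sum s c (self_affine (rate alpha) (ui_val x)).

Lemma exp_sum_self_affine_holder : exists2 C : R, 0 <= C &
  forall x y : R, 0 <= x <= 1 -> 0 <= y <= 1 ->
  `|exp_sum s c (self_affine (rate alpha) x) - exp_sum s c (self_affine (rate alpha) y)|
     <= C * `|x - y| `^ alpha.
Proof.
have [L L0 LP] := exp_sum_lipschitz s c 2.
exists (L * 18); first by rewrite mulr_ge0.
move=> x y x01 y01.
apply: (le_trans (LP _ _ (self_affine_range ha x01) (self_affine_range ha y01))).
rewrite -mulrA ler_wpM2l// self_affine_holder//.
- by case/andP: x01.
- by case/andP: y01.
- exact: dist_unit_itv.
Qed.

Lemma exp_sum_graph_dim : [/\ holder alpha exp_sum_graph,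
  hausdorff_dim (graph exp_sum_graph) = (2 - alpha)%:E &
  has_box_dim (graph exp_sum_graph) (2 - alpha)%:E].
Proof.
have [C C0 CP] := exp_sum_self_affine_holder.
have [u [v [e [u0 uv v1 e0 eP]]]] := exp_sum_expanding us gs g0 cg0 ltr01.
have [p [q [p0 pq q1 pqP]]] := self_affine_hit ha u0 uv v1.
have s0 : 0 < 2 - alpha by case/andP: ha => _ a1; rewrite subr_gt0 (lt_trans a1)// ltr1n.
have cov := holder_cube_coverable ha C0 CP.
have mass : has_mass (2 - alpha) (graph exp_sum_graph).
  apply: (@self_affine_has_mass _ alpha (Num.min 1 e) p q
    (fun x => exp_sum s c (self_affine (rate alpha) x))) => //.
    by rewrite lt_min ltr01 e0 ge_min lexx.
  move=> x y xI yI; apply: le_trans (eP _ _ (pqP _ xI) (pqP _ yI)).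
  by rewrite ler_wpM2r// ge_min lexx orbT.
split.
- exists (C + 1); split; first by rewrite ltr_wpDl.
  move=> x y; apply: (le_trans (CP _ _ (ui_val01 x) (ui_val01 y))).
  by rewrite ler_wpM2r ?powR_ge0// lerDl.
- exact: hausdorff_dim_eq.
- exact: has_box_dim_eq.
Qed.

(** The self-affine function takes values in both halves of an interval on which the exponential sum
    is injective, so the sum cannot vanish at both. *)
Lemma exp_sum_graph_neq0 : exists x, exp_sum_graph x != 0.
Proof.
have [u [v [e [u0 uv v1 e0 eP]]]] := exp_sum_expanding us gs g0 cg0 ltr01.
have uw : u < (u + v) / 2 by rewrite ltr_pdivlMr// mulr_natr mulr2n ltrD2l.
have wv : (u + v) / 2 < v by rewrite ltr_pdivrMr// mulr_natr mulr2n ltrD2r.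
have hit a b : u <= a -> a < b -> b <= v -> exists x : unit_interval R,
    a < self_affine (rate alpha) (ui_val x) < b.
  move=> ua ab bv.
  have [p [q [p0 pq q1 pqP]]] :=
    self_affine_hit ha (le_trans u0 ua) ab (le_trans bv v1).
  have p01 : p \in (`[0, 1]%classic : set R).
    by rewrite inE /= in_itv /= p0 (le_trans (ltW pq)).
  by exists (exist _ p p01); apply: pqP; rewrite lexx ltW.
have [x /andP[ux xw]] := hit _ _ (lexx _) uw (ltW wv).
have [y /andP[wy yv]] := hit _ _ (ltW uw) wv (lexx _).
apply: contrapT => H.
have Z z : exp_sum_graph z = 0.
  by apply/eqP; apply: contrapT => /negP hz; apply: H; exists z.
have := eP _ _ (introT andP (conj ux (lt_trans xw wv)))
  (introT andP (conj (lt_trans uw wy) yv)).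
have := Z x; have := Z y; rewrite /exp_sum_graph => -> ->.
rewrite subrr normr0 pmulr_rle0// normr_le0 subr_eq0 => /eqP E.
by move: (lt_trans xw wy); rewrite E ltxx.
Qed.

End ExpSumsOfSelfAffine.

Section Generators.
Variables (R : realType) (alpha : R).
Hypothesis ha : 0 < alpha < 1.
Notation A := (unit_interval R -> R)%type.

Definition generator (t : R) : A :=
  fun x => expR (indep t * self_affine (rate alpha) (ui_val x)).

(** The monomial [m] in the generators is the exponential of [exponent t m] times the self-affine
    function. *)
Definition exponent n (t : 'I_n -> R) (m : multinom n) : R :=
  \sum_(i < n) (m i)%:R * indep (t i).

Lemma exponent_gt0 n (t : 'I_n -> R) (m : multinom n) : m != mnm0 -> 0 < exponent t m.
Proof.
move=> m0; have [i mi] : exists i, m i != 0%N.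
  apply: contrapT => H; move/negP: m0; apply; apply/eqP/mnmP => i.
  by rewrite mnm0E; apply: contrapT => /eqP mi; apply: H; exists i.
rewrite /exponent (bigD1 i)//= ltr_wpDr//.
  by apply: sumr_ge0 => j _; rewrite mulr_ge0// ltW// indep_gt0.
by rewrite mulr_gt0 ?indep_gt0// ltr0n lt0n.
Qed.

Lemma exponent_inj n (t : 'I_n -> R) : injective t -> injective (exponent t).
Proof.
move=> t_inj m m' E; apply/mnmP => i.
suff : (m i)%:Z - (m' i)%:Z = 0 by move/eqP; rewrite subr_eq0 eqz_nat => /eqP.
apply: (@indep_independent R n t (fun i => (m i)%:Z - (m' i)%:Z) t_inj).
under eq_bigr do rewrite intrD rmorphN /= mulrBl.
by rewrite sumrB; apply/eqP; rewrite subr_eq0; apply/eqP.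
Qed.

(** Monomials are grouped by exponent, since [t] may take a value twice and distinct monomials may
    then share an exponent. *)
Lemma alg_eval_generator n (t : 'I_n -> R) (P : mpoly n R) :
  alg_eval (A := (unit_interval R -> R)%type) (fun i => generator (t i)) P =
  exp_sum_graph alpha (undup [seq exponent t m | m <- msupp P])
    (fun g => \sum_(m <- msupp P | exponent t m == g) mcoeff m P).
Proof.
apply/funext => x; rewrite /exp_sum_graph /exp_sum /alg_eval /mmap fct_sumE.
under [RHS]eq_bigr do rewrite mulr_suml.
rewrite (exchange_big_dep xpredT)//=; apply: eq_big_seq => m mP.
rewrite big_mkcond /= (bigD1_seq (exponent t m)) ?mem_undup ?map_f ?undup_uniq//=.
rewrite eqxx big1 ?addr0 => [|h]; last by rewrite eq_sym => /negbTE ->.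
rewrite mulrfctE; congr (_ * _); first by rewrite /= scalrfctE; exact: mulr1.
rewrite /mmap1 fct_prodE /exponent mulr_suml expR_sum; apply: eq_bigr => i _.
by rewrite exprfctE -mulrA expRM_natl.
Qed.

Lemma generator_inj : injective generator.
Proof.
move=> t t' E; apply: contrapT => /eqP tt'.
have [p [q [p0 pq q1 /(_ p)]]] := self_affine_hit ha (lexx _) (@ltr01 R) (lexx _).
rewrite lexx (ltW pq) => /(_ isT)/andP[F0 _].
have p01 : p \in (`[0, 1]%classic : set R).
  by rewrite inE /= in_itv /= p0 (le_trans (ltW pq)).
have /expR_inj /(mulIf (lt0r_neq0 F0)) tE := congr1 (@^~ (exist _ p p01)) E.
by move: tt'; rewrite (indep_inj tE) eqxx.
Qed.

End Generators.

Theorem theorem3p2 (R : realType) (alpha : R) (halpha : 0 < alpha < 1) :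
  strongly_algebrable (A := (unit_interval R -> R)%type) [set: R]
    [set f | [/\ holder alpha f,
                 hausdorff_dim (graph f) = (2 - alpha)%:E &
                 has_box_dim (graph f) (2 - alpha)%:E]].
Proof.
exists (range (generator alpha)); split.
- have inj : {in [set: R] &, injective (generator alpha)}.
    by move=> t t' _ _; exact: generator_inj.
  exact: inj_card_eq.
- move=> _ [n [x [P [xX P0 ->]]]].
  have /choice[t tx] : forall i, exists t, x i = generator alpha t.
    by move=> i; have [t _ <-] := xX i; exists t.
  have -> : x = fun i => generator alpha (t i).
    exact/funext.
  rewrite alg_eval_generator; set s := undup _; set c := (X in exp_sum_graph _ _ X).
  (* The [x i] may repeat, so coefficients can cancel: either one survives, with a positive exponent
     as there is no constant term, or the function is 0. *)
  have [/hasP[g gs cg]|/hasPn c0] := boolP (has (fun g => c g != 0) s).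
    left; apply: (@exp_sum_graph_dim _ _ halpha _ _ g) => //; first exact: undup_uniq.
    move: gs; rewrite mem_undup => /mapP[m mP ->].
    rewrite gt_eqF// exponent_gt0//; apply: contraTneq mP => ->.
    by rewrite mcoeff_msupp P0 eqxx.
  right; apply/funext => u; rewrite /exp_sum_graph /exp_sum big_seq big1// => g gs.
  by have := c0 g gs; rewrite negbK => /eqP ->; rewrite mul0r.
- move=> n x P x_inj xX P0; split=> [|->]; last by rewrite /alg_eval mmap0.
  have /choice[t tx] : forall i, exists t, x i = generator alpha t.
    by move=> i; have [t _ <-] := xX i; exists t.
  have xE : x = fun i => generator alpha (t i).
    exact/funext.
  have t_inj : injective t.
    by move=> i j tij; apply: x_inj; rewrite xE /= tij.
  rewrite xE alg_eval_generator => E0; apply/eqP; apply: contraTT isT => P_neq0.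
  have [m mP] : exists m, m \in msupp P.
    by case: (msupp P) (msupp_eq0 P) => [|m s _]; [rewrite (negbTE P_neq0)|exists m; rewrite mem_head].
  set s := undup _ in E0; set c := (X in exp_sum_graph _ _ X) in E0.
  have us : uniq s by exact: undup_uniq.
  have gs : exponent t m \in s by rewrite mem_undup map_f.
  have g0 : exponent t m != 0.
    rewrite gt_eqF// exponent_gt0//; apply: contraTneq mP => ->.
    by rewrite mcoeff_msupp P0 eqxx.
  have cg0 : c (exponent t m) != 0.
    (* Exponents of distinct monomials differ here, so the grouped coefficient is that of [m]
       alone. *)
    rewrite /c (eq_bigl (pred1 m)) => [|m']; last by rewrite (inj_eq (exponent_inj t_inj)).
    rewrite big_mkcond (bigD1_seq m) ?msupp_uniq//= eqxx big1 => [|m' /negbTE -> //].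
    by rewrite addr0 -mcoeff_msupp.
  have [u] := exp_sum_graph_neq0 halpha us gs g0 cg0.
  by rewrite E0 eqxx.
Qed.
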